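(* Let $\nu\in\mathscr{P}(M)$. If $\mathfrak a_\nu=\{0\}$, then $\mathfrak F_{\mathfrak a}(\mathrm A\cdot\nu)$ is convex in $\mathfrak a$ and the map \[ F^{\mathrm A}_\nu:\mathrm A\rightarrow\mathfrak a,\qquad F^{\mathrm A}_\nu(a)=\mathfrak F_{\mathfrak a}(a\cdot\nu), \] is a diffeomorphism onto $\mathfrak F_{\mathfrak a}(\mathrm A\cdot\nu)$.
   Context: Setting. $(Z,J,\omega)$ is a compact connected Kähler manifold, $\mathrm U$ is a compact connected Lie group with Lie algebra $\mathfrak u$ and complexification $\mathrm U^{\mathbb C}$, with Cartan decomposition $\mathrm U^{\mathbb C}=\mathrm U\exp(i\mathfrak u)$. $\mathrm U^{\mathbb C}$ acts holomorphically on $Z$, and $\mathrm U$ preserves $\omega$ and acts in a Hamiltonian fashion with $\mathrm U$-equivariant momentum mapping $\mu:Z\to\mathfrak u^*\cong\mathfrak u$ (identification via an $\mathrm{Ad}(\mathrm U)$-invariant scalar product). $B$ is a nondegenerate $\mathrm{Ad}(\mathrm U^{\mathbb C})$-invariant symmetric $\mathbb R$-bilinear form on $\mathfrak u^{\mathbb C}=\mathfrak u\oplus i\mathfrak u$, positive definite on $i\mathfrak u$, negative definite on $\mathfrak u$, with $\mathfrak u\perp i\mathfrak u$; $\langle\cdot,\cdot\rangle$ is its restriction to $i\mathfrak u$. $\mathrm G\subseteq\mathrm U^{\mathbb C}$ is a compatible subgroup, i.e. a closed connected subgroup with $\mathrm G=\mathrm K\exp(\mathfrak p)$, where $\mathrm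 K=\mathrm G\cap\mathrm U$ and $\mathfrak p=\mathfrak g\cap i\mathfrak u$ is $\mathrm K$-stable. The $\mathrm G$-gradient map $\mu_{\mathfrak p}:Z\to\mathfrak p$ is $-i$ times the orthogonal projection of $\mu$ onto $i\mathfrak p\subset\mathfrak u$; conventions are normalized so that for every $\beta\in\mathfrak p$ the fundamental vector field $\beta_Z$, $\beta_Z(z)=\frac{d}{dt}|_{t=0}\exp(t\beta)\cdot z$, is the gradient of $\mu_{\mathfrak p}^\beta=\langle\mu_{\mathfrak p},\beta\rangle$ for the Kähler metric determined by $\omega$ and $J$. $M\subset Z$ is a compact $\mathrm G$-stable real submanifold, and $\mu_{\mathfrak p}$ also denotes the restriction to $M$. Measures. $\mathscr P(M)$ is the set of Borel probability measures on $M$ with the weak$^*$ topology; $\mathrm G$ acts on it by pushforward, $g\cdot\nu=g_*\nu$. Abelian subgroup. $\mathfrak a\subset\mathfrak p$ is a Lie subalgebra of $\mathfrak g$ (necessarily Abelian), $\mathrm A=\exp(\mathfrak a)$, $\mu_{\mathfrak a}=\pi_{\mathfrak a}\circ\mu_{\mathfrak p}:M\to\mathfrak a$ with $\pi_{\mathfrak a}$ the orthogonal projection onto $\mathfrak a$, and $\mathfrak F_{\mathfrak a}:\mathscr P(M)\to\mathfrak a$, $\mathfrak F_{\mathfrak a}(\nu)=\int_M\mu_{\mathfrak a}(x)\,d\nu(x)$. For $\nu\in\mathscr P(M)$, $\mathrm A_\nu$ is the isotropy group of $\nu$ in $\mathrm A$ and $\mathfrak a_\nu$ its Lie algebra. 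*)

(* Defs.v *)
From HB Require Import structures.
From mathcomp Require Import all_boot all_order all_algebra.
From mathcomp Require Import all_classical all_reals all_analysis.

Set Implicit Arguments.
Unset Strict Implicit.
Unset Printing Implicit Defensive.

Import Order.TTheory GRing.Theory Num.Theory.
Import numFieldNormedType.Exports.

Local Open Scope classical_set_scope.
Local Open Scope ring_scope.

Section Smooth.
Context {R : realType}.
Implicit Types E F : normedModType R.

(* In finite dimension this is the class C^k on the open set O. *)
Fixpoint Ck_on E F (k : nat) (O : set E) (f : E -> F) : Prop :=
  match k with
  | 0 => forall x, O x -> {for x, continuous f}
  | k'.+1 => (forall x, O x -> differentiable f x) /\
             (forall v, Ck_on k' O (fun x => 'D_v f x))
  end.

Definition smooth_on E F (O : set E) (f : E -> F) : Prop :=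
  forall k, Ck_on k O f.

(* JE and JF are the multiplications by i on E and F; the second clause is the
   system of Cauchy-Riemann equations. *)
Definition holo_on E F (JE : E -> E) (JF : F -> F) (O : set E) (f : E -> F) :
    Prop :=
  smooth_on O f /\ forall x v, O x -> 'D_(JE v) f x = JF ('D_v f x).

(* The functions are total; they are meaningful on [cdom] and on its image. *)
Record chart (T : topologicalType) (E : normedModType R) := Chart {
  cdom : set T;
  cfun :> T -> E;
  cinv : E -> T;
  cdom_open : open cdom;
  cimg_open : open (cfun @` cdom);
  cfunK : forall x, cdom x -> cinv (cfun x) = x;
  cfun_continuous : forall x, cdom x -> {for x, continuous cfun};
  cinv_continuous : forall y, (cfun @` cdom) y -> {for y, continuous cinv} }.

Program Definition id_chart E : chart E E :=
  @Chart E E setT id id _ _ _ _ _.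
Next Obligation. by move=> E; exact: openT. Qed.
Next Obligation. by move=> E; rewrite image_id; exact: openT. Qed.
Next Obligation. by []. Qed.
Next Obligation. by move=> E x _; exact: cvg_id. Qed.
Next Obligation. by move=> E x _; exact: cvg_id. Qed.

Definition flat_atlas E : set (chart E E) := [set @id_chart E].

Section ProdChart.
Context (T1 T2 : topologicalType) (E1 E2 : normedModType R).
Variables (c1 : chart T1 E1) (c2 : chart T2 E2).

Let pdom : set (T1 * T2) := cdom c1 `*` cdom c2.
Let pfun (x : T1 * T2) : E1 * E2 := (c1 x.1, c2 x.2).
Let pinv (y : E1 * E2) : T1 * T2 := (cinv c1 y.1, cinv c2 y.2).

Let pimgE : pfun @` pdom = (c1 @` cdom c1) `*` (c2 @` cdom c2).
Proof.
apply/seteqP; split=> [_ [[x y] [/= dx dy] <-]|[a b] [/= [x dx <-] [y dy <-]]].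
  by split=> /=; [exists x|exists y].
by exists (x, y).
Qed.

Let open_setX (S1 S2 : topologicalType) (A1 : set S1) (A2 : set S2) :
  open A1 -> open A2 -> open (A1 `*` A2).
Proof.
move=> o1 o2; rewrite openE => -[x y] [/= Ax Ay].
by exists (A1, A2) => //=; split; exact: open_nbhs_nbhs.
Qed.

Fact prod_chart_dom_open : open pdom.
Proof. by apply: open_setX; exact: cdom_open. Qed.

Fact prod_chart_img_open : open (pfun @` pdom).
Proof. by rewrite pimgE; apply: open_setX; exact: cimg_open. Qed.

Fact prod_chart_funK x : pdom x -> pinv (pfun x) = x.
Proof. by case: x => x y [/= dx dy]; rewrite /pinv /= !cfunK. Qed.

Fact prod_chart_fun_continuous x : pdom x -> {for x, continuous pfun}.
Proof.
case: x => x y [/= dx dy]; apply: cvg_pair => /=.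
  by apply: (cvg_comp _ _ cvg_fst); exact: cfun_continuous.
by apply: (cvg_comp _ _ cvg_snd); exact: cfun_continuous.
Qed.

Fact prod_chart_inv_continuous y :
  (pfun @` pdom) y -> {for y, continuous pinv}.
Proof.
rewrite pimgE; case: y => x y [/= dx dy]; apply: cvg_pair => /=.
  by apply: (cvg_comp _ _ cvg_fst); exact: cinv_continuous.
by apply: (cvg_comp _ _ cvg_snd); exact: cinv_continuous.
Qed.

Definition prod_chart : chart (T1 * T2)%type (E1 * E2)%type :=
  Chart prod_chart_dom_open prod_chart_img_open prod_chart_funK
        prod_chart_fun_continuous prod_chart_inv_continuous.

End ProdChart.

Definition prod_atlas (T1 T2 : topologicalType) (E1 E2 : normedModType R)
    (A1 : set (chart T1 E1)) (A2 : set (chart T2 E2)) :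
    set (chart (T1 * T2)%type (E1 * E2)%type) :=
  [set c | exists c1 c2, [/\ A1 c1, A2 c2 & c = prod_chart c1 c2]].

(* Maps defined on an arbitrary subset S: near each point of S, and in charts,
   f is the restriction to S of a map of class P on an open set.  When S is an
   embedded submanifold and P is [smooth_on], these are the smooth maps on S. *)
Definition locally_repr (X Y : topologicalType) E F
    (P : set E -> (E -> F) -> Prop)
    (AX : set (chart X E)) (AY : set (chart Y F)) (S : set X) (f : X -> Y) :
    Prop :=
  forall x, S x -> exists (c : chart X E) (d : chart Y F) (W : set E)
      (h : E -> F),
    [/\ [/\ AX c, cdom c x, AY d & cdom d (f x)],
        open W /\ W (c x),
        P W h &
        forall y, S y -> cdom c y -> W (c y) ->
          cdom d (f y) /\ d (f y) = h (c y)].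

Definition smooth_map (X Y : topologicalType) E F
    (AX : set (chart X E)) (AY : set (chart Y F)) (S : set X) (f : X -> Y) :=
  locally_repr (@smooth_on E F) AX AY S f.

Definition diffeo_onto (X Y : topologicalType) E F
    (AX : set (chart X E)) (AY : set (chart Y F))
    (S : set X) (T : set Y) (f : X -> Y) : Prop :=
  [/\ f @` S = T,
      smooth_map AX AY S f &
      exists g : Y -> X,
        smooth_map AY AX T g /\ forall x, S x -> g (f x) = x].

End Smooth.

Arguments id_chart {R} E.
Arguments flat_atlas {R} E.

Definition imx (R : realType) (n : nat) : 'M[R]_(n + n) :=
  block_mx 0 1%:M (- 1%:M) 0.

(* (x, y) |-> (- y, x) *)
Definition muli (R : realType) (n : nat) (v : 'rV[R]_(n + n)) :
    'rV[R]_(n + n) := v *m imx R n.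

Record complex_manifold (R : realType) (n : nat) := ComplexManifold {
  cm_top :> ptopologicalType;
  cm_hausdorff : hausdorff_space cm_top;
  cm_second_countable : second_countable (T := cm_top);
  atlas : set (chart cm_top 'rV[R]_(n + n));
  atlas_cover : forall x, exists2 c, atlas c & cdom c x;
  atlas_holo : forall c d, atlas c -> atlas d ->
    holo_on (@muli R n) (@muli R n)
      (c @` (cdom c `&` cdom d)) (d \o cinv c) }.

Definition holo_map (R : realType) (m n : nat)
    (X : complex_manifold R m) (Y : complex_manifold R n) (f : X -> Y) :=
  locally_repr (holo_on (@muli R m) (@muli R n))
    (@atlas R m X) (@atlas R n Y) setT f.

Definition holo_map2 (R : realType) (l m n : nat) (X : complex_manifold R l)
    (Y : complex_manifold R m) (W : complex_manifold R n) (f : X -> Y -> W) :=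
  locally_repr
    (holo_on (fun p => (muli p.1, muli p.2)) (@muli R n))
    (prod_atlas (@atlas R l X) (@atlas R m Y)) (@atlas R n W) setT
    (fun p => f p.1 p.2).

Definition real_submanifold (R : realType) (m : nat)
    (Z : complex_manifold R m) (M : set Z) : Prop :=
  forall x, M x -> exists (k : nat) (V : set Z) (O : set 'rV[R]_k)
      (f : Z -> 'rV[R]_k),
    [/\ open V, V x, open O &
        diffeo_onto (@atlas R m Z) (flat_atlas 'rV[R]_k) (M `&` V) O f].

Definition form_of (R : realType) (n : nat) (A : 'M[R]_n) (v w : 'rV[R]_n) : R :=
  (v *m A *m w^T) 0 0.

Section Kahler.
Context {R : realType} {m : nat} (Z : complex_manifold R m).
Local Notation V := 'rV[R]_(m + m).

(* A 2-form is given by its Gram matrix in every chart of the atlas, as a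
   function of the coordinates. *)
Definition chart_form := chart Z V -> V -> 'M[R]_(m + m).

Implicit Types omega : chart_form.

(* f^* omega = omega; for f = id this is the compatibility of the local
   expressions of omega under changes of charts. *)
Definition preserves_form omega (f : Z -> Z) : Prop :=
  forall (c d : chart Z V) (z : Z), atlas c -> atlas d -> cdom c z ->
    cdom d (f z) -> forall v w : V,
    let h := d \o f \o cinv c in
    form_of (omega c (c z)) v w =
    form_of (omega d (d (f z))) ('D_v h (c z)) ('D_w h (c z)).

(* g(v, w) = omega(v, J w) *)
Definition metric omega (c : chart Z V) (x v w : V) : R :=
  form_of (omega c x) v (muli w).

Definition is_kahler omega : Prop :=
  preserves_form omega id /\
  forall c, atlas c -> let O := c @` cdom c in
  [/\ smooth_on O (omega c),
      forall x v w, O x ->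
        form_of (omega c x) w v = - form_of (omega c x) v w,
      forall x v w, O x ->
        form_of (omega c x) (muli v) (muli w) = form_of (omega c x) v w,
      forall x v, O x -> v != 0 -> 0 < metric omega c x v v &
      (* d omega = 0, evaluated on constant vector fields *)
      forall x (v1 v2 v3 : V), O x ->
        'D_v1 (fun y => form_of (omega c y) v2 v3) x +
        'D_v2 (fun y => form_of (omega c y) v3 v1) x +
        'D_v3 (fun y => form_of (omega c y) v1 v2) x = 0].

End Kahler.

(* The Lie algebra (tangent space at the unit) is C^n, read in [chart1]. *)
Record complex_lie_group (R : realType) (n : nat) := ComplexLieGroup {
  lg_manifold :> complex_manifold R n;
  lmul : lg_manifold -> lg_manifold -> lg_manifold;
  lone : lg_manifold;
  linv : lg_manifold -> lg_manifold;
  lmulA : associative lmul;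
  lmul1 : left_id lone lmul;
  lmulV : left_inverse lone linv lmul;
  lmul_holo : holo_map2 lmul;
  linv_holo : holo_map linv;
  chart1 : chart lg_manifold 'rV[R]_(n + n);
  chart1_atlas : atlas chart1;
  chart1_dom : cdom chart1 lone }.

Arguments lone {R n c}.
Arguments chart1 {R n c}.

Section LieGroup.
Context {R : realType} {n : nat} (H : complex_lie_group R n).
Local Notation L := 'rV[R]_(n + n).
Implicit Types (S : set H) (expo : L -> H).

Definition is_exponential expo : Prop :=
  [/\ smooth_map (flat_atlas L) (@atlas R n H) setT expo,
      forall X (s t : R),
        expo ((s + t) *: X) = lmul (expo (s *: X)) (expo (t *: X)) &
      forall X, is_derive (0 : R^o) (1 : R^o)
        (fun t : R^o => chart1 (expo (t *: X)) : L) X].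

Definition Ad expo (g : H) (X : L) : L :=
  derive1 (fun t : R => chart1 (lmul (lmul g (expo (t *: X))) (linv g))) 0.

Definition bracket expo (X Y : L) : L :=
  derive1 (fun t : R => Ad expo (expo (t *: X)) Y) 0.

Definition is_subgroup S : Prop :=
  [/\ S lone, forall x y, S x -> S y -> S (lmul x y) &
      forall x, S x -> S (linv x)].

Definition lie_of expo S : set L := [set X | forall t : R, S (expo (t *: X))].

(* For a closed subgroup S, [lie_of] is the Lie algebra of S; that it is a
   subspace is part of [is_lie_algebra]. *)
Definition is_lie_algebra expo S (h : {vspace L}) : Prop :=
  [set` h] = lie_of expo S.

Definition ivs (h : {vspace L}) : {vspace L} :=
  (linfun (mulmxr (imx R n) : L -> L) @: h)%VS.

End LieGroup.

(* The compact group U is given as a subgroup of its complexification H.  The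
   last clause is the universal property; since continuous homomorphisms of Lie
   groups are smooth, continuity of f is enough. *)
Definition is_complexification (R : realType) (n : nat)
    (H : complex_lie_group R n) (expo : 'rV[R]_(n + n) -> H)
    (U : set H) (u : {vspace 'rV[R]_(n + n)}) : Prop :=
  [/\ [/\ is_subgroup U, compact U, connected U & is_lie_algebra expo U u],
      (u + ivs u)%VS = fullv /\ (u :&: ivs u)%VS = 0%VS,
      forall g : H, exists! kX : H * 'rV[R]_(n + n),
        [/\ U kX.1, kX.2 \in ivs u & g = lmul kX.1 (expo kX.2)] &
      forall (k : nat) (H' : complex_lie_group R k) (f : H -> H'),
        {within U, continuous f} ->
        (forall x y, U x -> U y -> f (lmul x y) = lmul (f x) (f y)) ->
        exists! F : H -> H',
          [/\ holo_map F, forall x y, F (lmul x y) = lmul (F x) (F y) &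
              forall x, U x -> F x = f x]].

Definition is_compatible (R : realType) (n : nat)
    (H : complex_lie_group R n) (expo : 'rV[R]_(n + n) -> H)
    (U : set H) (u : {vspace 'rV[R]_(n + n)})
    (G : set H) (g : {vspace 'rV[R]_(n + n)}) : Prop :=
  let K := G `&` U in
  let p := (g :&: ivs u)%VS in
  [/\ is_subgroup G, closed G /\ connected G, is_lie_algebra expo G g,
      forall k X, K k -> X \in p -> Ad expo k X \in p &
      G = [set x | exists k X, [/\ K k, X \in p & x = lmul k (expo X)]]].

Section Forms.
Context {R : realType} {n : nat} (H : complex_lie_group R n).
Local Notation L := 'rV[R]_(n + n).
Variables (expo : L -> H) (U : set H) (u : {vspace L}).

(* Only the restriction of Q to u matters. *)
Definition is_invariant_scalar_product (Q : 'M[R]_(n + n)) : Prop :=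
  [/\ forall X Y, X \in u -> Y \in u -> form_of Q X Y = form_of Q Y X,
      forall X, X \in u -> X != 0 -> 0 < form_of Q X X &
      forall k X Y, U k -> X \in u -> Y \in u ->
        form_of Q (Ad expo k X) (Ad expo k Y) = form_of Q X Y].

Definition is_admissible_form (B : 'M[R]_(n + n)) : Prop :=
  [/\ B^T = B /\ B \in unitmx,
      forall g X Y, form_of B (Ad expo g X) (Ad expo g Y) = form_of B X Y,
      forall X, X \in ivs u -> X != 0 -> 0 < form_of B X X,
      forall X, X \in u -> X != 0 -> form_of B X X < 0 &
      forall X Y, X \in u -> Y \in ivs u -> form_of B X Y = 0].

End Forms.

Definition is_orth_proj (R : realType) (n : nat) (Q : 'M[R]_n)
    (W : {vspace 'rV[R]_n}) (x y : 'rV[R]_n) : Prop :=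
  y \in W /\ forall w, w \in W -> form_of Q (x - y) w = 0.

Section Actions.
Context {R : realType} {n m : nat}.
Context (H : complex_lie_group R n) (Z : complex_manifold R m).
Local Notation L := 'rV[R]_(n + n).
Local Notation V := 'rV[R]_(m + m).
Variables (expo : L -> H) (act : H -> Z -> Z).

Definition is_holomorphic_action : Prop :=
  [/\ forall z, act lone z = z,
      forall g h z, act (lmul g h) z = act g (act h z) &
      holo_map2 act].

(* The fundamental vector field of X at z, read in the chart c. *)
Definition fundamental_field (c : chart Z V) (X : L) (z : Z) : V :=
  derive1 (fun t : R => c (act (expo (t *: X)) z)) 0.

(* The identification of the dual of u with u is through the scalar product Q.
   Sign: d mu^xi = omega(_, xi_Z); with g = omega(_, J _) and
   mu_p = - i proj(mu), this is the sign that makes beta_Z, rather than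
   - beta_Z, the gradient of mu_p^beta. *)
Definition is_momentum_map (U : set H) (u : {vspace L}) (Q : 'M[R]_(n + n))
    (omega : chart_form Z) (mu : Z -> L) : Prop :=
  [/\ smooth_map (@atlas R m Z) (flat_atlas L) setT mu,
      forall z, mu z \in u,
      forall k z, U k -> mu (act k z) = Ad expo k (mu z) &
      forall xi c z v, xi \in u -> atlas c -> cdom c z ->
        'D_v (fun x => form_of Q (mu (cinv c x)) xi) (c z) =
        form_of (omega c (c z)) v (fundamental_field c xi z)].

Definition is_gradient_map (Q : 'M[R]_(n + n)) (p : {vspace L})
    (mu mup : Z -> L) : Prop :=
  forall z, exists2 y, is_orth_proj Q (ivs p) (mu z) y & mup z = - muli y.

Definition gradient_normalized (B : 'M[R]_(n + n)) (p : {vspace L})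
    (omega : chart_form Z) (mup : Z -> L) : Prop :=
  forall beta c z v, beta \in p -> atlas c -> cdom c z ->
    'D_v (fun x => form_of B (mup (cinv c x)) beta) (c z) =
    metric omega c (c z) (fundamental_field c beta z) v.

End Actions.

Definition borel (T : ptopologicalType) := g_sigma_algebraType (@open T).

Definition vintegral (R : realType) (n : nat) (T : ptopologicalType)
    (M : set T) (f : T -> 'rV[R]_n) (nu : set (borel T) -> \bar R) : 'rV[R]_n :=
  \row_j fine (integral nu M (fun x => (f x 0 j)%:E)).

Definition push (R : realType) (T : ptopologicalType) (f : T -> T)
    (nu : set (borel T) -> \bar R) : set (borel T) -> \bar R :=
  pushforward nu (f : borel T -> borel T).

Definition measure_isotropy (R : realType) (T : ptopologicalType)
    (H : Type) (act : H -> T -> T) (A : set H)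
    (nu : set (borel T) -> \bar R) : set H :=
  [set x | A x /\ forall E : set (borel T), measurable E ->
                    push (act x) nu E = nu E].

(* Main.v *)
(* The commutator of two elements X = iX', Y = iY' of a is -[X', Y'], which lies
   in u, while a is contained in iu; hence a is Abelian and exp is additive on a.
   In coordinates t = (t_1, ..., t_k) of a, the map f(t) = F(exp t) therefore has
   derivative <D_v f(t), v> = \int_M |v_Z(exp(t) z)|^2 d nu(z) >= 0, because v_Z
   is the gradient of mu_a^v. If this vanishes, then v_Z vanishes at exp(t) z for
   nu-almost every z, so exp(sv) fixes nu-almost every z and v belongs to a_nu = 0.
   So f is a smooth map of R^k whose derivative is everywhere positive definite:
   it is strictly monotone, hence injective and a diffeomorphism onto an open set.
   The range is convex by the continuity method: strict monotonicity bounds the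
   preimages of the points of a segment between two values in terms of its ends.
   No potential of f is needed. *)

Require Import Defs.
From HB Require Import structures.
From mathcomp Require Import all_boot all_order all_algebra.
From mathcomp Require Import all_classical all_reals all_analysis.
From mathcomp Require Import measurable_realfun ring lra.

Set Implicit Arguments.
Unset Strict Implicit.
Unset Printing Implicit Defensive.

Import Order.TTheory GRing.Theory Num.Theory.
Import numFieldNormedType.Exports.

Local Open Scope classical_set_scope.
Local Open Scope ring_scope.

(** * Maps of class C^k *)

Section Ck.
Context {R : realType}.
Implicit Types E F G : normedModType R.

(** Smoothness of [F] and of its inverse is tested in the ambient group [UC] and in its Lie algebra,
    so no manifold structure on [A] is built: locally [F] extends to an open subset of [UC], and its
    inverse extends to an open subset of the Lie algebra as a linear map followed by the inverse of
    [f] and the exponential. The bracket is defined as a derivative of [Ad], which hides its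
    antisymmetry; the commutativity of [a] needs it. It is recovered by expressing the bracket
    through mixed second derivatives of the multiplication in a chart. The uniqueness of
    one-parameter subgroups, and the passage from a zero of [v_Z] to a fixed point of [exp(sv)],
    rest on the same fact: a curve whose velocity vanishes at every time, each time in some chart,
    is constant. The entries of [f] are pairings with a basis of [a] rather than coordinates in that
    basis, so that [<D_v f, v>] is the integral above for an arbitrary basis. Derivatives pass under
    the integral sign because compactness of [Z] makes the estimates uniform in the point. *)

Lemma open_near_eq E F (O : set E) (f g : E -> F) x :
  open O -> O x -> (forall y, O y -> f y = g y) -> \near x, f x = g x.
Proof.
move=> oO Ox fg; apply: filterS (open_nbhs_nbhs (conj oO Ox)).
by move=> y; exact: fg.
Qed.

Lemma differentiable_epsP E F (f : E -> F) (l : {linear E -> F}) x :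
  continuous l ->
  (forall e, 0 < e -> \forall h \near (0 : E),
    `|f (h + x) - f x - l h| <= e * `|h|) ->
  is_diff x f l.
Proof.
move=> cl H.
have e : f \o shift x = cst (f x) + l +o_ (0 : E) id.
  by apply/eqaddoP => _/posnumP[e]; near=> h; rewrite /= opprD addrA; near: h;
    apply: H.
have dl := diff_unique cl e.
by apply: DiffDef => //; apply/diff_locallyP; rewrite dl.
Unshelve. all: by end_near. Qed.

Lemma differentiable_eps E F (f : E -> F) x : differentiable f x ->
  forall e, 0 < e -> \forall h \near (0 : E),
    `|f (h + x) - f x - 'd f x h| <= e * `|h|.
Proof.
move=> /diff_locally /eqaddoP H e e0.
by near=> h; rewrite -addrA -opprD; near: h; apply: H.
Unshelve. all: by end_near. Qed.

Lemma differentiable_near_eq E F (f g : E -> F) x :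
  (\near x, f x = g x) -> differentiable f x -> differentiable g x.
Proof.
move=> fg df; have fgx := nbhs_singleton fg.
suff : is_diff x g ('d f x) by case.
apply: differentiable_epsP => [|e e0]; first exact: diff_continuous.
near=> h; rewrite -fgx.
have <- : f (h + x) = g (h + x).
  by near: h; move: fg; rewrite (near_shift 0) subr0.
by near: h; exact: differentiable_eps.
Unshelve. all: by end_near. Qed.

Lemma Ck_on_ext E F k (O : set E) (f g : E -> F) : open O ->
  (forall x, O x -> f x = g x) -> Ck_on k O f -> Ck_on k O g.
Proof.
move=> oO; elim: k f g => [|k IH] f g fg /=.
  move=> cf x Ox; apply: cvg_trans; last by rewrite -(fg _ Ox); exact: cf.
  by apply: near_eq_cvg; exact: (open_near_eq oO Ox).
move=> [df Df]; split=> [x Ox|v].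
  by apply: differentiable_near_eq (df _ Ox); exact: (open_near_eq oO Ox).
apply: IH (Df v) => x Ox; apply: near_eq_derive.
exact: (open_near_eq oO Ox).
Qed.

Lemma Ck_on_sub E F k (O O' : set E) (f : E -> F) :
  O' `<=` O -> Ck_on k O f -> Ck_on k O' f.
Proof.
move=> OO; elim: k f => [|k IH] f /=; first by move=> cf x /OO; exact: cf.
by move=> [df Df]; split=> [x /OO|v]; [exact: df|exact: IH].
Qed.

Lemma Ck_onS E F k (O : set E) (f : E -> F) : Ck_on k.+1 O f -> Ck_on k O f.
Proof.
elim: k f => [|k IH] f; first by move=> [df _] x /df /differentiable_continuous.
by move=> [df Df]; split => // v; apply: IH; exact: Df.
Qed.

Lemma Ck_on_cst E F k (O : set E) (a : F) : Ck_on k O (fun _ : E => a).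
Proof.
elim: k a => [|k IH] a /=; first by move=> x _; exact: cvg_cst.
split=> [x _|v]; first exact: differentiable_cst.
have -> : 'D_v (fun _ : E => a) = (fun _ => 0) by apply/funext => x;
  exact: derive_cst.
exact: IH.
Qed.

Lemma Ck_onD E F k (O : set E) (f g : E -> F) : open O ->
  Ck_on k O f -> Ck_on k O g -> Ck_on k O (fun x => f x + g x).
Proof.
move=> oO; elim: k f g => [|k IH] f g /=.
  by move=> cf cg x Ox; apply: cvgD; [exact: cf|exact: cg].
move=> [df Df] [dg Dg]; split=> [x Ox|v].
  by apply: differentiableD; [exact: df|exact: dg].
apply: Ck_on_ext (IH _ _ (Df v) (Dg v)) => // x Ox.
by rewrite [RHS]deriveD//; apply: diff_derivable; [exact: df|exact: dg].
Qed.

Lemma Ck_on_sum E F k (O : set E) (I : Type) (r : seq I) (f : I -> E -> F) :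
  open O -> (forall i, Ck_on k O (f i)) -> Ck_on k O (fun x => \sum_(i <- r) f i x).
Proof.
move=> oO Cf; elim: r => [|i r IH].
  apply: (Ck_on_ext oO _ (Ck_on_cst k O 0)) => x _; by rewrite big_nil.
apply: (Ck_on_ext oO _ (Ck_onD oO (Cf i) IH)) => x _; by rewrite big_cons.
Qed.

Lemma Ck_onM E k (O : set E) (f g : E -> R) : open O ->
  Ck_on k O f -> Ck_on k O g -> Ck_on k O (fun x => f x * g x).
Proof.
move=> oO; elim: k f g => [|k IH] f g.
  by move=> cf cg x Ox; apply: cvgM; [exact: cf|exact: cg].
move=> Cf Cg; have [[df Df] [dg Dg]] := (Cf, Cg); split=> [x Ox|v].
  by apply: differentiableM; [exact: df|exact: dg].
have C1 := IH _ _ (Ck_onS Cf) (Dg v); have C2 := IH _ _ (Ck_onS Cg) (Df v).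
apply: (Ck_on_ext oO _ (Ck_onD oO C1 C2)) => x Ox.
by rewrite [RHS]deriveM//; apply: diff_derivable; [exact: df|exact: dg].
Qed.

Lemma Ck_on_prod E k (O : set E) (I : Type) (r : seq I) (f : I -> E -> R) :
  open O -> (forall i, Ck_on k O (f i)) -> Ck_on k O (fun x => \prod_(i <- r) f i x).
Proof.
move=> oO Cf; elim: r => [|i r IH].
  apply: (Ck_on_ext oO _ (@Ck_on_cst E R k O 1)) => x _; by rewrite big_nil.
apply: (Ck_on_ext oO _ (Ck_onM oO (Cf i) IH)) => x _; by rewrite big_cons.
Qed.

(** The derivative is [- r^-2 'D_v r], where [r^-1] is of class C^k by induction. *)
Lemma Ck_onV E k (O : set E) (r : E -> R) : open O ->
  (forall x, O x -> r x != 0) -> Ck_on k O r -> Ck_on k O (fun x => (r x)^-1).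
Proof.
move=> oO r0; elim: k => [|k IH] Cr.
  by move=> x Ox; apply: cvgV; [exact: r0|exact: Cr].
have [dr Dr] := Cr; have Ci := IH (Ck_onS Cr).
split=> [x Ox|v]; first by apply: differentiableV; [exact: dr|exact: r0].
have C1 := Ck_onM oO (Ck_onM oO Ci Ci) (Ck_onM oO (@Ck_on_cst E R k O (-1)) (Dr v)).
apply: (Ck_on_ext oO _ C1) => x Ox; rewrite deriveV ?r0//.
  by rewrite /GRing.scale/= -exprVn; ring.
exact/diff_derivable/dr.
Qed.

Lemma is_diff_derive E F (f : E -> F) df x v :
  is_diff x f df -> 'D_v f x = df v.
Proof. by move=> d; rewrite deriveE // diff_val. Qed.

Lemma derive_comp E F G (f : E -> F) (g : F -> G) x v :
  differentiable f x -> differentiable g (f x) ->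
  'D_v (g \o f) x = 'D_('D_v f x) g (f x).
Proof.
move=> df dg; rewrite deriveE; last exact: differentiable_comp.
by rewrite diff_comp //= -!deriveE.
Qed.

(** The direction [l v] does not depend on the point, so a derivative of [h \o A] is again a
    composition with [A] and the induction closes for arbitrary normed modules. *)
Lemma Ck_on_comp_affine E F G k (O : set F) (A : E -> F) (l : E -> F) (h : F -> G) :
  open O -> (forall x, is_diff x A l) -> Ck_on k O h -> Ck_on k (A @^-1` O) (h \o A).
Proof.
move=> oO dA.
have cA : continuous A.
  by move=> x; apply: differentiable_continuous; case: (dA x).
have oA : open (A @^-1` O) by apply: open_comp => // x _; exact: cA.
elim: k h => [|k IH] h /=.
  by move=> ch x Ox; apply: continuous_comp; [exact: cA|exact: ch].
move=> [dh Dh]; split=> [x Ox|v].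
  by apply: differentiable_comp; [case: (dA x)|exact: dh].
apply: (Ck_on_ext oA _ (IH _ (Dh (l v)))) => x Ox.
rewrite derive_comp ?(is_diff_derive _ (dA x))//.
exact: dh.
Qed.

Lemma differentiable_rowP E n (f : E -> 'rV[R]_n) x :
  differentiable f x <-> forall j, differentiable (fun y => f y 0 j) x.
Proof.
split=> [df j|df].
  exact: (differentiable_comp df (differentiable_coord (f x) 0 j)).
have -> : f = \sum_j (fun y => f y 0 j *: ('e_j : 'rV[R]_n)).
  by apply/funext => y; rewrite fct_sumE; exact: row_sum_delta.
by apply: differentiable_sum => j; exact: differentiableZl.
Qed.

Lemma derive_row E n (f : E -> 'rV[R]_n) x v j :
  derivable f x v -> ('D_v f x) 0 j = 'D_v (fun y => f y 0 j) x.
Proof. by move=> df; rewrite derive_mx // mxE. Qed.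

Lemma continuous_rowP (T : topologicalType) n (f : T -> 'rV[R]_n) x :
  {for x, continuous f} <-> forall j, {for x, continuous (fun y => f y 0 j)}.
Proof.
split=> [cf j|cf].
  exact: (continuous_comp cf (@coord_continuous _ _ _ 0 j _)).
have -> : f = fun y => \sum_j f y 0 j *: ('e_j : 'rV[R]_n).
  by apply/funext => y; exact: row_sum_delta.
by apply: cvg_big => [|j _]; [exact: add_continuous|apply: cvgZr_tmp; exact: cf].
Qed.

Lemma continuous_sub (T : topologicalType) E (f g : T -> E) x :
  {for x, continuous f} -> {for x, continuous g} ->
  {for x, continuous (fun y => f y - g y)}.
Proof. by move=> cf cg; apply: cvgB; [exact: cf|exact: cg]. Qed.

Lemma continuous_add (T : topologicalType) E (f g : T -> E) x :
  {for x, continuous f} -> {for x, continuous g} ->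
  {for x, continuous (fun y => f y + g y)}.
Proof. by move=> cf cg; apply: cvgD; [exact: cf|exact: cg]. Qed.

Lemma continuous_pair (T U W : topologicalType) (f : T -> U) (g : T -> W) x :
  {for x, continuous f} -> {for x, continuous g} ->
  {for x, continuous (fun y => (f y, g y))}.
Proof. by move=> cf cg; apply: cvg_pair; [exact: cf|exact: cg]. Qed.

Lemma continuous_line E (v x : E) (t : R) :
  {for t, continuous (fun t : R => t *: v + x)}.
Proof.
by apply: continuous_add; [exact: scalel_continuous|exact: cvg_cst].
Qed.

Lemma continuous_const (T U : topologicalType) (a : U) (x : T) :
  {for x, continuous (fun _ : T => a)}.
Proof. exact: cvg_cst. Qed.

Lemma continuous_self (T : topologicalType) (x : T) :
  {for x, continuous (fun y : T => y)}.
Proof. exact: cvg_id. Qed.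

Lemma Ck_on_rowP E n k (O : set E) (f : E -> 'rV[R]_n) : open O ->
  Ck_on k O f <-> forall j, Ck_on k O (fun y => f y 0 j).
Proof.
move=> oO; elim: k f => [|k IH] f /=.
  split=> [cf j x Ox|cf x Ox]; first by move/continuous_rowP: (cf _ Ox); apply.
  by apply/continuous_rowP => j; exact: cf.
split=> [[df Df] j|Cf].
  split=> [x Ox|v]; first by move/differentiable_rowP: (df _ Ox); apply.
  move/IH: (Df v) => /(_ j); apply: Ck_on_ext => // x Ox.
  by rewrite derive_row //; apply: diff_derivable; exact: df.
have df x : O x -> differentiable f x.
  by move=> Ox; apply/differentiable_rowP => j; apply: (Cf j).1.
split=> // v; apply/IH => j; apply: Ck_on_ext ((Cf j).2 v) => // x Ox.
by rewrite derive_row //; apply: diff_derivable; exact: df.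
Qed.

Lemma derive_row_sum n F (g : 'rV[R]_n -> F) x v : differentiable g x ->
  'D_v g x = \sum_j v 0 j *: 'D_('e_j) g x.
Proof.
move=> dg; rewrite deriveE // [in LHS](row_sum_delta v) linear_sum.
by apply: eq_bigr => j _; rewrite linearZ deriveE.
Qed.

(** The direction ['D_v f x] varies with [x]. Expanding it in the standard basis turns the
    derivative into a sum of products involving derivatives of [g] in fixed directions, to which the
    induction hypothesis applies. *)
Lemma Ck_on_compR E n k (O : set E) (O' : set 'rV[R]_n) (f : E -> 'rV[R]_n)
    (g : 'rV[R]_n -> R) : open O -> open O' -> (forall x, O x -> O' (f x)) ->
  Ck_on k O f -> Ck_on k O' g -> Ck_on k O (g \o f).
Proof.
move=> oO oO' fO; elim: k f g fO => [|k IH] f g fO.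
  by move=> cf cg x Ox; apply: continuous_comp; [exact: cf|exact: cg (fO _ Ox)].
move=> Cf [dg Dg]; have [df Df] := Cf; split=> [x Ox|v].
  by apply: differentiable_comp; [exact: df|exact: dg (fO _ Ox)].
have C1 : Ck_on k O (fun x => \sum_j ('D_v f x) 0 j * 'D_('e_j) g (f x)).
  apply: Ck_on_sum => // j; apply: Ck_onM => //.
    by move: (Df v) j => /Ck_on_rowP; apply.
  exact: IH (Ck_onS Cf) (Dg _).
apply: (Ck_on_ext oO _ C1) => x Ox.
have dfx := df _ Ox; have dgx := dg _ (fO _ Ox).
by rewrite [RHS]derive_comp // [RHS](derive_row_sum _ dgx).
Qed.

Lemma Ck_on_comp E n p k (O : set E) (O' : set 'rV[R]_n) (f : E -> 'rV[R]_n)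
    (g : 'rV[R]_n -> 'rV[R]_p) : open O -> open O' -> (forall x, O x -> O' (f x)) ->
  Ck_on k O f -> Ck_on k O' g -> Ck_on k O (g \o f).
Proof.
move=> oO oO' fO Cf /Ck_on_rowP Cg; apply/Ck_on_rowP => // j.
exact: Ck_on_compR fO Cf (Cg oO' j).
Qed.

Lemma Ck_on_mulmx E n p k (O : set E) (f : E -> 'rV[R]_n) (A : 'M[R]_(n, p)) :
  open O -> Ck_on k O f -> Ck_on k O (fun x => f x *m A).
Proof.
move=> oO /Ck_on_rowP Cf; apply/Ck_on_rowP => // j.
have C : Ck_on k O (fun x => \sum_i f x 0 i * A i j).
  by apply: Ck_on_sum => // i; apply: Ck_onM => //; [exact: Cf|exact: Ck_on_cst].
by apply: (Ck_on_ext oO _ C) => x _; rewrite mxE.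
Qed.

Lemma Ck_on_id E k (O : set E) : Ck_on k O (fun x : E => x).
Proof.
case: k => [x _|k]; first exact: continuous_self.
split=> [x _|v]; first by have [] := is_diff_id x.
have -> : 'D_v (fun x : E => x) = (fun _ => v) by apply/funext => x;
  exact: derive_id.
exact: Ck_on_cst.
Qed.

Lemma continuous_mulmxr n p (A : 'M[R]_(n, p)) :
  continuous (fun x : 'rV[R]_n => x *m A).
Proof. by move=> x; apply: (Ck_on_mulmx (k := 0) A openT (Ck_on_id _ _)). Qed.

Lemma is_derive_line E F (f : E -> F) x v (t : R) :
  derivable f (t *: v + x) v ->
  is_derive t 1 (fun t : R => f (t *: v + x)) ('D_v f (t *: v + x)).
Proof.
have e :
  (fun h : R =>
    h^-1 *: (((fun t : R => f (t *: v + x)) \o shift t) (h *: 1) - f (t *: v + x))) =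
    (fun h => h^-1 *: ((f \o shift (t *: v + x)) (h *: v) - f (t *: v + x))).
  by apply/funext => h /=; rewrite [h%:A]mulr1 scalerDl addrA.
by move=> df; apply: DeriveDef; rewrite /derivable /derive e.
Qed.

Lemma MVT_line E (f : E -> R) x v (s : R) : 0 < s ->
  (forall t, 0 <= t <= s -> derivable f (t *: v + x) v) ->
  exists2 t, 0 < t < s & f (s *: v + x) - f x = s * 'D_v f (t *: v + x).
Proof.
move=> s0 df.
have d t : t \in `]0,
  s[ -> is_derive t 1 (fun t : R => f (t *: v + x)) ('D_v f (t *: v + x)).
  by rewrite in_itv /= => /andP[t0 ts]; apply: is_derive_line; apply: df;
    rewrite !ltW.
have c : {within `[0, s], continuous (fun t : R => f (t *: v + x))}.
  apply: derivable_within_continuous => t; rewrite in_itv /= => ts.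
  by have [] := is_derive_line (df _ ts).
have [t ts e] := MVT s0 d c.
exists t => //; move: e; rewrite scale0r add0r subr0 => ->; exact: mulrC.
Qed.

Lemma derive_translate E F (f : E -> F) c x v :
  'D_v (fun y => f (c + y)) x = 'D_v f (c + x) /\
  (derivable f (c + x) v -> derivable (fun y => f (c + y)) x v).
Proof.
have e :
  (fun h : R => h^-1 *: (((fun y => f (c + y)) \o shift x) (h *: v) - f (c + x))) =
    (fun h => h^-1 *: ((f \o shift (c + x)) (h *: v) - f (c + x))).
  by apply/funext => h /=; rewrite addrCA.
by rewrite /derive /derivable e.
Qed.

Lemma second_difference E (O : set E) (f : E -> R) x v w (s : R) : 0 < s ->
  (forall t t', 0 <= t <= s -> 0 <= t' <= s -> O (t' *: w + (t *: v + x))) ->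
  Ck_on 2 O f ->
  exists t t', [/\ 0 <= t <= s, 0 <= t' <= s &
    f (s *: w + (s *: v + x)) - f (s *: v + x) - f (s *: w + x) + f x =
    s * (s * 'D_w ('D_v f) (t' *: w + (t *: v + x)))].
Proof.
move=> s0 sO [df Df].
have s_ge0 : 0 <= (0 : R) <= s by rewrite lexx ltW.
have s_les : 0 <= s <= s by rewrite lexx ltW.
have O0 t : 0 <= t <= s -> O (t *: v + x).
  by move=> ts; have := sO t 0 ts s_ge0; rewrite scale0r add0r.
(* The mean value theorem is used twice: for [g] in the direction [v], then for ['D_v f] in the
   direction [w]. *)
pose g y := f (s *: w + y) - f y.
have dg t : 0 <= t <= s -> is_derive (t *: v + x) v g
    ('D_v f (s *: w + (t *: v + x)) - 'D_v f (t *: v + x)).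
  move=> ts; have [e d] := derive_translate f (s *: w) (t *: v + x) v.
  rewrite -e; apply: is_deriveB; apply: derivableP.
    by apply: d; apply: diff_derivable; apply: df; exact: sO.
  by apply: diff_derivable; apply: df; exact: O0.
have [t /andP[t0 ts] e] :=
  MVT_line (f := g) s0 (fun t ts => let: DeriveDef d _ := dg t ts in d).
have tt : 0 <= t <= s by rewrite !ltW.
have [t' /andP[t0' ts'] e'] : exists2 t', 0 < t' < s &
    'D_v f (s *: w + (t *: v + x)) - 'D_v f (t *: v + x) =
    s * 'D_w ('D_v f) (t' *: w + (t *: v + x)).
  have dv r : 0 <= r <= s -> derivable ('D_v f) (r *: w + (t *: v + x)) w.
    by move=> rs; apply: diff_derivable; exact: (Df v).1 _ (sO t r tt rs).
  exact: (MVT_line s0 dv).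
exists t, t'; split=> //; first by rewrite !ltW.
rewrite -e'; have := dg t tt => -[_ <-]; rewrite -e /g; ring.
Qed.

Lemma continuous_dist E F (f : E -> F) x e : {for x, continuous f} -> 0 < e ->
  \forall y \near x, `|f x - f y| <= e.
Proof. by move=> /cvgrPdist_le; apply. Qed.

Lemma continuous2_ball E F (O : set E) (f g : E -> F) x e : open O -> O x ->
  {for x, continuous f} -> {for x, continuous g} -> 0 < e ->
  exists2 d : R, 0 < d & forall y, `|y - x| < d ->
    [/\ O y, `|f x - f y| <= e & `|g x - g y| <= e].
Proof.
move=> oO Ox cf cg e0.
have /nbhs_normP[d /= d0 xd] : \forall y \near x,
    O y /\ (`|f x - f y| <= e /\ `|g x - g y| <= e).
  apply: filterI; first exact: open_nbhs_nbhs.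
  by apply: filterI; exact: continuous_dist.
by exists d => // y; rewrite distrC => yx; have [? []] := xd y yx.
Qed.

(** The second difference over the parallelogram spanned by [s *: v] and [s *: w] is symmetric in
    [v] and [w]. By [second_difference] it is [s^2] times either mixed derivative at points near
    [x], and both derivatives are continuous at [x]. *)
Lemma schwarz E (O : set E) (f : E -> R) x v w : open O -> O x -> Ck_on 2 O f ->
  'D_v ('D_w f) x = 'D_w ('D_v f) x.
Proof.
move=> oO Ox Cf; have [df Df] := Cf.
have ca := (Df w).2 v x Ox; have cb := (Df v).2 w x Ox.
apply/eqP; rewrite -subr_eq0 -normr_le0; apply/ler_addgt0Pr => e e0; rewrite add0r.
have e2 : 0 < e / 2 by rewrite divr_gt0.
have [d d0 xd] := continuous2_ball oO Ox ca cb e2.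
(* Small enough for the whole parallelogram to lie within [d] of [x]; the summand 1 keeps the
   denominator positive when [v] and [w] vanish. *)
pose s := d / 2 / (`|v| + `|w| + 1).
have D0 : 0 < `|v| + `|w| + 1 by rewrite ltr_wpDl.
have s0 : 0 < s by rewrite !divr_gt0.
have near_box (a b : E) t t' : `|a| + `|b| = `|v| + `|w| -> 0 <= t <= s ->
  0 <= t' <= s ->
    `|t' *: b + (t *: a + x) - x| < d.
  move=> ab /andP[t0 ts] /andP[t'0 t's]; rewrite addrA addrK.
  apply: (@le_lt_trans _ _ (s * (`|v| + `|w| + 1))); last first.
    by rewrite /s divfK ?gt_eqF// ltr_pdivrMr// ltr_pMr// ltr1n.
  rewrite (le_trans (ler_normD _ _))// !normrZ !ger0_norm// -ab.
  have ? := normr_ge0 a; have ? := normr_ge0 b.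
  have : t * `|a| <= s * `|a| by rewrite ler_wpM2r.
  have : t' * `|b| <= s * `|b| by rewrite ler_wpM2r.
  rewrite !mulrDr mulr1; have := ltW s0; lra.
have vw : `|w| + `|v| = `|v| + `|w| by rewrite addrC.
have O1 t t' : 0 <= t <= s -> 0 <= t' <= s -> O (t' *: w + (t *: v + x)).
  by move=> ts ts'; have [] := xd _ (near_box v w t t' erefl ts ts').
have O2 t t' : 0 <= t <= s -> 0 <= t' <= s -> O (t' *: v + (t *: w + x)).
  by move=> ts ts'; have [] := xd _ (near_box w v t t' vw ts ts').
have [t [t' [ts ts' D1]]] := second_difference s0 O1 Cf.
have [r [r' [rs rs' D2]]] := second_difference s0 O2 Cf.
have [_ _ A1] := xd _ (near_box v w t t' erefl ts ts').
have [_ A2 _] := xd _ (near_box w v r r' vw rs rs').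
have alg (a b p q d1 d2 : R) : d1 = s * (s * p) -> d2 = s * (s * q) -> d1 = d2 ->
    `|b - p| <= e / 2 -> `|a - q| <= e / 2 -> `|a - b| <= e.
  have ss := negbT (gt_eqF s0).
  move=> -> -> /(mulfI ss)/(mulfI ss) -> bq aq.
  rewrite -(subrKA q) (le_trans (ler_normD _ _))// [leRHS]splitr lerD//.
  by rewrite distrC.
apply: (alg _ _ _ _ _ _ D1 D2 _ A1 A2).
have -> : s *: w + (s *: v + x) = s *: v + (s *: w + x) by rewrite addrCA.
ring.
Qed.

Lemma schwarz_row E n (O : set E) (f : E -> 'rV[R]_n) x v w :
  open O -> O x -> Ck_on 2 O f -> 'D_v ('D_w f) x = 'D_w ('D_v f) x.
Proof.
move=> oO Ox Cf; have [df Df] := Cf; apply/rowP => j.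
have Dr u : \near x, ('D_u f x) 0 j = 'D_u (fun y => f y 0 j) x.
  apply: (open_near_eq oO Ox) => y Oy; rewrite derive_row//.
  exact/diff_derivable/df.
have e u u' : ('D_u ('D_u' f) x) 0 j = 'D_u ('D_u' (fun y => f y 0 j)) x.
  rewrite -(near_eq_derive u (Dr u')) derive_row //.
  exact: diff_derivable ((Df u').1 x Ox).
have Cj : Ck_on 2 O (fun y => f y 0 j) by move: j {Dr e};
  apply: (proj1 (Ck_on_rowP _ _ oO)).
exact: (etrans (e v w) (etrans (schwarz v w oO Ox Cj) (esym (e w v)))).
Qed.

Lemma differentiable_self (E : normedModType R) (x : E) :
  differentiable (fun y : E => y) x.
Proof. by have [] := is_diff_id x. Qed.

Lemma derive_add (E F : normedModType R) (f : E -> F) x v w : differentiable f x ->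
  'D_(v + w) f x = 'D_v f x + 'D_w f x.
Proof.
move=> df; have e u := deriveE u df.
by rewrite (e (v + w)) (e v) (e w); exact: linearD.
Qed.

Lemma derive_mulmx (E : normedModType R) n p (f : E -> 'rV[R]_n) (A : 'M[R]_(n, p))
  x v :
  differentiable f x -> 'D_v (fun y => f y *m A) x = 'D_v f x *m A.
Proof.
move=> df; pose l : {linear 'rV[R]_n -> 'rV[R]_p} := mulmxr A.
have cl : continuous l by exact: continuous_mulmxr.
have dl := linear_differentiable (f x) cl.
have := derive_comp v df dl; rewrite [in RHS]deriveE // (diff_lin _ cl); exact.
Qed.

(** Since [b 0 = 0], the difference quotient of the product is that of [b] times [q h], so
    continuity of [q] at 0 is enough. *)
Lemma is_derive_scale_at0 (F : normedModType R) (b : R -> R) (q : R -> F) :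
  derivable b 0 1 -> b 0 = 0 -> {for 0, continuous q} ->
  is_derive (0 : R) 1 (fun t => b t *: q t) ('D_1 b 0 *: q 0).
Proof.
move=> db b0 cq.
have e :
  (fun h : R => h^-1 *: (((fun t => b t *: q t) \o shift 0) (h *: 1) - b 0 *: q 0)) =
    (fun h : R => (h^-1 *: ((b \o shift 0) (h *: 1) - b 0)) *: q h).
  apply/funext => h /=.
  by rewrite b0 scale0r !subr0 addr0 [h%:A]mulr1 scalerA.
have c :
  (fun h : R => h^-1 *: (((fun t => b t *: q t) \o shift 0) (h *: 1) - b 0 *: q 0))
    @ 0^' -->
    'D_1 b 0 *: q 0.
  by rewrite e; apply: cvgZ => //; exact: cvg_within_filter cq.
apply: DeriveDef; first by apply/cvg_ex; exists ('D_1 b 0 *: q 0).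
exact: cvg_lim.
Qed.

(** Parametrizing the segment as [t *: (b - a) + a] treats both orders of [a] and [b] at once. *)
Lemma derive_line_eq0 (f : R -> R) (a b : R) :
  (forall t, `|t - a| <= `|b - a| -> is_derive t 1 f 0) -> f b = f a.
Proof.
move=> df.
have dl (t : R) : 0 <= t <= 1 -> is_derive (t *: (b - a) + a) (b - a) f 0.
  move=> /andP[t0 t1]; have tab : `|t *: (b - a) + a - a| <= `|b - a|.
    by rewrite addrK normrZ ger0_norm// ler_piMl.
  have [d e] := df _ tab.
  have /derivable1_diffP dd := d.
  apply: DeriveDef; first exact: diff_derivable.
  rewrite deriveE// -[X in 'd _ _ X = _]mulr1 [LHS]linearZ -deriveE// e.
  exact: scaler0.
have dl' (t : R) : 0 <= t <= 1 -> derivable f (t *: (b - a) + a) (b - a).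
  by move=> t01; have [] := dl t t01.
have [t /andP[t0 t1]] := MVT_line ltr01 dl'.
have [_ ->] := dl t (introT andP (conj (ltW t0) (ltW t1))).
by rewrite mulr0 scale1r subrK => /eqP; rewrite subr_eq0 => /eqP.
Qed.

End Ck.

(** * Maps with positive definite derivative *)

Section MonotoneInverse.
Context {R : realType} {k : nat}.
Local Notation V := 'rV[R]_k.

Definition dot (x y : V) : R := \sum_j x 0 j * y 0 j.

Lemma dotC x y : dot x y = dot y x.
Proof. by apply: eq_bigr => j _; rewrite mulrC. Qed.

Lemma dotDl x y z : dot (x + y) z = dot x z + dot y z.
Proof. by rewrite -big_split; apply: eq_bigr => j _; rewrite mxE mulrDl. Qed.

Lemma dotZl a x y : dot (a *: x) y = a * dot x y.
Proof. by rewrite mulr_sumr; apply: eq_bigr => j _; rewrite mxE mulrA. Qed.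

Lemma dotNl x y : dot (- x) y = - dot x y.
Proof. by rewrite -scaleN1r dotZl mulN1r. Qed.

Lemma dotDr x y z : dot z (x + y) = dot z x + dot z y.
Proof. by rewrite dotC dotDl !(dotC z). Qed.

Lemma dotZr a x y : dot x (a *: y) = a * dot x y.
Proof. by rewrite dotC dotZl dotC. Qed.

Lemma dotNr x y : dot x (- y) = - dot x y.
Proof. by rewrite dotC dotNl dotC. Qed.

Lemma dot0l x : dot 0 x = 0.
Proof. by rewrite -[0](scale0r x) dotZl mul0r. Qed.

Lemma dot0r x : dot x 0 = 0.
Proof. by rewrite dotC dot0l. Qed.

Lemma dot_ge0 x : 0 <= dot x x.
Proof. by apply: sumr_ge0 => j _; rewrite -expr2 sqr_ge0. Qed.

Lemma dot_eq0 x : dot x x = 0 -> x = 0.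
Proof.
move/eqP; rewrite psumr_eq0; last by move=> j _; rewrite -expr2 sqr_ge0.
move/allP => x0; apply/rowP => j; rewrite mxE; apply/eqP.
by have := x0 j (mem_index_enum _); rewrite mulf_eq0 orbb.
Qed.

Lemma continuous_dot (T : topologicalType) (f g : T -> V) x :
  {for x, continuous f} -> {for x, continuous g} ->
  {for x, continuous (fun y => dot (f y) (g y))}.
Proof.
move=> /continuous_rowP cf /continuous_rowP cg.
apply: cvg_big => [|j _]; first exact: add_continuous.
by apply: cvgM; [exact: cf|exact: cg].
Qed.

Lemma is_derive_dot (E : normedModType R) (f g : E -> V) x v :
  derivable f x v -> derivable g x v ->
  is_derive x v (fun y => dot (f y) (g y))
    (dot ('D_v f x) (g x) + dot (f x) ('D_v g x)).
Proof.
move=> df dg.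
have dj j : is_derive x v (fun y => f y 0 j * g y 0 j)
    (('D_v f x) 0 j * g x 0 j + f x 0 j * ('D_v g x) 0 j).
  have dfj := (derivable_mxP f x v).1 df 0 j;
    have dgj := (derivable_mxP g x v).1 dg 0 j.
  rewrite (derive_row j df) (derive_row j dg).
  apply: is_derive_eq (is_deriveM (derivableP dfj) (derivableP dgj)) _.
  by rewrite addrC; congr (_ + _); exact: mulrC.
have := is_derive_sum dj.
rewrite (_ : \sum_(i < k) _ = fun y => dot (f y) (g y)); last first.
  by apply/funext => y; rewrite fct_sumE.
by move=> d; apply: is_derive_eq d _; rewrite /dot -big_split.
Qed.

Variable f : V -> V.
Hypothesis Cf : smooth_on setT f.
Hypothesis fpos : forall x v : V, v != 0 -> 0 < dot ('D_v f x) v.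

Let df x : differentiable f x.
Proof. exact: (Cf 1).1. Qed.

Let cf : continuous f.
Proof. by move=> x; exact: differentiable_continuous. Qed.

(** By the mean value theorem for [<f, v>] along the segment, the left-hand pairing is [<'D_v f, v>]
    at some point of it. *)
Lemma strictly_monotone (x v : V) : v != 0 -> 0 < dot (f (v + x) - f x) v.
Proof.
move=> v0.
have d y : is_derive y v (fun y => dot (f y) v) (dot ('D_v f y) v).
  have [d e] := is_derive_dot (g := fun=> v) (diff_derivable (df y))
    (derivable_cst v y v).
  apply: DeriveDef => //; rewrite e.
  by rewrite derive_cst dot0r addr0.
have d1 t : 0 <= t <= 1 -> derivable (fun y => dot (f y) v) (t *: v + x) v.
  by move=> _; have [] := d (t *: v + x).
have [t _] := MVT_line ltr01 d1.
have [_ ->] := d (t *: v + x).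
rewrite !scale1r mul1r dotDl dotNl => ->; exact: fpos.
Qed.

Lemma strictly_monotone_injective : injective f.
Proof.
move=> x y fxy; apply/eqP; rewrite -subr_eq0; apply/negPn/negP => v0.
have := strictly_monotone y v0; rewrite subrK fxy subrr.
by rewrite dot0l ltxx.
Qed.

(** Strict monotonicity from [v + x] in the direction [(s - 1) *: v]. It carries bounds on a sphere
    outwards along rays. *)
Lemma monotone_growth (x v : V) (s : R) : 1 <= s ->
  dot (f (v + x) - f x) v <= dot (f (s *: v + x) - f x) v.
Proof.
rewrite le_eqVlt => /orP[/eqP<-|s1]; first by rewrite scale1r.
have [->|v0] := eqVneq v 0; first by rewrite scaler0.
have s10 : 0 < s - 1 by rewrite subr_gt0.
have sv0 : (s - 1) *: v != 0 by rewrite scaler_eq0 negb_or gt_eqF.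
have := strictly_monotone (v + x) sv0; rewrite dotZr pmulr_rgt0//.
rewrite addrA scalerBl scale1r subrK !dotDl !dotNl; lra.
Qed.

(* At a minimum [x] of [x |-> |f x - y|^2] inside the ball, the derivative in
   the direction [v = f x - y] is [2 <D_v f x, v>], which forces [v = 0]. *)
Lemma monotone_locally_onto (x0 : V) (r : R) : 0 < r ->
  \forall y \near f x0, exists2 x, `|x - x0| < r & f x = y.
Proof.
move=> r0.
pose K := [set x : V | `|x - x0| <= r]; pose S := [set x : V | `|x - x0| = r].
have cN : continuous (fun x : V => `|x - x0|).
  move=> x; have c : {for x, continuous (fun x : V => x - x0)}.
    by apply: continuous_sub; [exact: continuous_self|exact: continuous_const].
  exact: (continuous_comp c (@norm_continuous _ _ _)).
have bK : bounded_set K.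
  exists (r + `|x0|); split; first exact: num_real.
  move=> M rM x /= xK; rewrite -(subrK x0 x) (le_trans (ler_normD _ _))//.
  by rewrite (le_trans _ (ltW rM))// lerD2r.
have cK : compact K.
  apply: bounded_closed_compact => //.
  exact: (closed_comp (fun x _ => cN x) (@closed_le R r)).
have cS : compact S.
  apply: (subclosed_compact _ cK); last by move=> x; rewrite /S /K /= => ->.
  exact: (closed_comp (fun x _ => cN x) (@closed_eq R r)).
pose e y x := dot (f x - y) (f x - y).
have ce (y x : V) : {for (x, y), continuous (fun p : V * V => e p.2 p.1)}.
  have h : {for (x, y), continuous (fun p : V * V => f p.1 - p.2)}.
    apply: continuous_sub; last exact: cvg_snd.
    by apply: (cvg_comp _ _ cvg_fst); exact: cf.
  exact: continuous_dot.
(* By injectivity the squared distance from [f x] to [f x0] is positive on the sphere. By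
   compactness, for all [y] near [f x0], [e y] is larger on the sphere than at the centre, so its
   minimum over the ball is attained inside. *)
have nS : \forall y \near f x0, S `<=` [set x | 0 < e y x - e y x0].
  have nc := proj1 (compact_near_coveringP S) cS.
  apply: (nc V (nbhs (f x0)) (fun y x => 0 < e y x - e y x0) (nbhs_filter _)) =>
    x Sx.
  have : {for (x, f x0), continuous (fun p : V * V => e p.2 p.1 - e p.2 x0)}.
    apply: continuous_sub; first exact: ce.
    have h : {for (x, f x0), continuous (fun p : V * V => f x0 - p.2)}.
      by apply: continuous_sub; [exact: continuous_const|exact: cvg_snd].
    exact: continuous_dot.
  move=> /(_ [set z | 0 < z]); apply; apply: open_nbhs_nbhs; split;
    first exact: open_gt.
  rewrite /= {2}/e subrr dot0l subr0 lt_neqAle dot_ge0 andbT eq_sym;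
    apply/eqP => /dot_eq0/subr0_eq fxx.
  by move: Sx; rewrite /S /= (strictly_monotone_injective fxx) subrr normr0 => r00;
    move: r0; rewrite -r00 ltxx.
near=> y.
have K0 : K !=set0 by exists x0; rewrite /K /= subrr normr0 ltW.
have cey : continuous (e y).
  move=> x; have h : {for x, continuous (fun p : V => f p - y)}.
    by apply: continuous_sub; [exact: cf|exact: continuous_const].
  exact: (continuous_dot h h).
have [x Kx xmin] := EVT_min_rV K0 cK (continuous_subspaceT cey).
rewrite inE in Kx.
have xr : `|x - x0| < r.
  rewrite lt_neqAle Kx andbT; apply/eqP => Sx.
  have : (S `<=` [set x | 0 < e y x - e y x0]) by near: y.
  move=> /(_ x Sx) /=; rewrite subr_gt0; apply/negP; rewrite -leNgt.
  by apply: xmin; rewrite inE /K /= subrr normr0 ltW.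
exists x => //; apply/eqP; rewrite -subr_eq0; apply/eqP.
set v := f x - y.
have [d d0 xd] : exists2 d : R, 0 < d & forall t : R, `|t| < d -> K (t *: v + x).
  have : \forall t \near (0 : R), `|t *: v + x - x0| < r.
    have c : {for (0 : R), continuous (fun t : R => `|t *: v + x - x0|)}.
      exact:
        (@continuous_comp R V R (fun t => t *: v + x) (fun z => `|z - x0|) 0
          (@continuous_line _ V v x 0) (cN _)).
    apply: (c [set z | z < r]); apply: open_nbhs_nbhs; split; first exact: open_lt.
    by rewrite /= scale0r add0r.
  move=> /nbhs_normP[d /= d0 xd]; exists d => // t td; rewrite /K /= ltW//;
    apply: xd.
  by rewrite /ball_ /= sub0r normrN.
have dv z : is_derive z v (e y) (2 * dot ('D_v f z) (f z - y)).
  have dz : is_derive z v (fun x => f x - y) ('D_v f z - 0).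
    have dz : derivable f z v := diff_derivable (df z).
    exact: (is_deriveB (derivableP dz) (is_derive_cst y z v)).
  have [d1 e1] := dz; apply: is_derive_eq (is_derive_dot d1 d1) _.
  by rewrite e1 subr0 (dotC (f z - y)) mulr2n mulrDl mul1r.
have dt (t : R) : is_derive t 1 (fun t => e y (t *: v + x))
    (2 * dot ('D_v f (t *: v + x)) (f (t *: v + x) - y)).
  have [d1 <-] := dv (t *: v + x); exact: is_derive_line.
have := @derive1_at_min R (fun t => e y (t *: v + x)) (- d) d 0.
case.
- by rewrite -subr_ge0 opprK addr_ge0 ?ltW.
- by move=> t _; have [] := dt t.
- by rewrite in_itv /= oppr_lt0 d0.
- move=> t; rewrite in_itv /= => td; rewrite scale0r add0r; apply: xmin.
  by rewrite inE; apply: xd; rewrite ltr_norml.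
move=> _; have := dt 0 => -[_ ->]; rewrite scale0r add0r -/v => /eqP.
rewrite mulf_eq0 pnatr_eq0 /= => /eqP v0; apply/eqP/negPn/negP => vN0.
by have := fpos x vN0; rewrite v0 ltxx.
Unshelve. all: by end_near. Qed.

Lemma dot_le_norm : exists2 C, 0 <= C & forall x y : V,
  `|dot x y| <= C * (`|x| * `|y|).
Proof.
(* The norm of row vectors is the maximum norm, so each of the [k] products is at most [|x| |y|]. *)
exists k%:R; first exact: ler0n.
move=> x y; rewrite (le_trans (ler_norm_sum _ _ _))//.
have cb (z : V) j : `|z 0 j| <= `|z|.
  by rewrite [leRHS]/Num.Def.normr/= mx_normrE; exact: (le_bigmax _ _ (0, j)).
apply: (@le_trans _ _ (\sum_(j < k) `|x| * `|y|)).
  by apply: ler_sum => j _; rewrite normrM ler_pM.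
by rewrite sumr_const card_ord mulr_natl.
Qed.

(** Compactness gives a positive lower bound on the unit sphere around [x0], and [monotone_growth]
    propagates it along rays. *)
Lemma monotone_coercive (x0 : V) : exists2 c, 0 < c &
  forall x, 1 <= `|x - x0| -> c * `|x - x0| <= dot (f x - f x0) (x - x0).
Proof.
pose S := [set x : V | `|x| = 1].
have cS : compact S.
  apply: bounded_closed_compact.
    by exists 1; split; [exact: num_real|move=> M M1 x /= ->; exact: ltW].
  exact: (closed_comp (fun x _ => @norm_continuous _ V x) (@closed_eq R 1)).
(* The bound is treated as a parameter near 0: at [c = 0] the inequality is strict monotonicity, and
   the compact sphere lets it persist for all small [c]. *)
have nS : \forall c \near (0 : R),
  S `<=` [set x | 0 < dot (f (x + x0) - f x0) x - c].
  have nc := proj1 (compact_near_coveringP S) cS.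
  apply:
    (nc R (nbhs (0 : R)) (fun c x => 0 < dot (f (x + x0) - f x0) x - c)
      (nbhs_filter _)) => x Sx.
  have :
    {for (x, 0 : R),
      continuous (fun p : V * R => dot (f (p.1 + x0) - f x0) p.1 - p.2)}.
    apply: continuous_sub; last exact: cvg_snd.
    have c1 : {for (x, 0 : R), continuous (fun p : V * R => p.1)} by exact: cvg_fst.
    apply: (continuous_dot _ c1); apply: continuous_sub;
      last exact: continuous_const.
    apply: (@continuous_comp _ _ _ (fun p : V * R => p.1 + x0) f); last exact: cf.
    by apply: continuous_add c1 _; exact: continuous_const.
  move=> /(_ [set z | 0 < z]); apply; apply: open_nbhs_nbhs; split;
    first exact: open_gt.
  rewrite /= subr0; apply: strictly_monotone.
  by apply/eqP => x0'; move: Sx; rewrite /S /= x0' normr0 => /eqP;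
    rewrite eq_sym oner_eq0.
have [c [c0 cS']] : exists c : R,
  0 < c /\ S `<=` [set x | 0 < dot (f (x + x0) - f x0) x - c].
  have /nbhs_normP[d /= d0 Hd] := nS; exists (d / 2); split;
    first by rewrite divr_gt0.
  by apply: Hd;
    rewrite /ball_ /= sub0r normrN gtr0_norm ?divr_gt0// ltr_pdivrMr// ltr_pMr//
      ltr1n.
exists c => // x x1.
have x0' : `|x - x0| != 0 by rewrite gt_eqF// (lt_le_trans ltr01).
pose u := `|x - x0|^-1 *: (x - x0).
have Su : S u by rewrite /S /= normrZ normfV normr_id mulVf.
have xu : x - x0 = `|x - x0| *: u by rewrite scalerA divff// scale1r.
have -> : dot (f x - f x0) (x - x0) = `|x - x0| * dot (f x - f x0) u by rewrite
  -dotZr -xu.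
rewrite mulrC ler_wpM2l// (le_trans _ (_ : dot (f (u + x0) - f x0) u <= _))//.
  by rewrite ltW// -subr_gt0; exact: cS'.
by have := monotone_growth x0 u x1; rewrite -xu subrK.
Qed.

(* Continuity method along the segment: strict monotonicity bounds the
   preimages of its points, so the points reached form a closed set, which is
   open by [monotone_locally_onto]. *)
Lemma monotone_range_convex (x0 x1 : V) (s : R) : 0 <= s <= 1 ->
  exists x, f x = f x0 + s *: (f x1 - f x0).
Proof.
pose y (t : R) := f x0 + t *: (f x1 - f x0); rewrite -/(y s).
have cy : continuous y.
  move=> t;
    exact:
      (continuous_add (@continuous_const R V (f x0) t)
        (@scalel_continuous R V (f x1 - f x0) t)).
have [c0 c0_gt0 H0] := monotone_coercive x0.
have [c1 c1_gt0 H1] := monotone_coercive x1.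
have [C C0 HC] := dot_le_norm.
pose D := C * (`|f x1 - f x0| * `|x1 - x0|).
have D0 : 0 <= D by rewrite mulr_ge0// mulr_ge0.
(* The summand [D / c0] serves the points at distance at least 1 from both [x0] and [x1]; the other
   two serve the points closer than 1 to one of them. *)
pose r := D / c0 + `|x1 - x0| + 1.
have Dc0 : 0 <= D / c0 by rewrite divr_ge0 // ltW.
have bnd t x : 0 <= t <= 1 -> f x = y t -> `|x - x0| <= r.
  move=> /andP[t0 t1] fx.
  have [h0|h0] := ltP `|x - x0| 1.
    by rewrite /r (le_trans (ltW h0))// lerDr addr_ge0.
  have [h1|h1] := ltP `|x - x1| 1.
    rewrite -(subrKA x1) (le_trans (ler_normD _ _))// /r.
    have := normr_ge0 (x1 - x0); have := ltW h1; lra.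
  have G0 := H0 x h0; have G1 := H1 x h1.
  have e0 : f x - f x0 = t *: (f x1 - f x0) by rewrite fx /y addrAC subrr add0r.
  have e1 : f x - f x1 = - ((1 - t) *: (f x1 - f x0)).
    by rewrite fx /y scalerBl scale1r !opprB [f x0 + _]addrC -addrA.
  move: G0 G1; rewrite e0 e1 dotNl !dotZl.
  (* Put [a = <f x1 - f x0, x - x0>] and [b = <f x1 - f x0, x - x1>]. Coercivity bounds [t a] and
     [- (1 - t) b] below by positive numbers, so [b < 0 < a]. Hence
     [c0 |x - x0| <= t a <= a <= a - b <= D]. *)
  have ab : dot (f x1 - f x0) (x - x0) - dot (f x1 - f x0) (x - x1) =
            dot (f x1 - f x0) (x1 - x0).
    by rewrite -dotNr -dotDr; congr (dot _ _); rewrite opprB [LHS]addrC addrA subrK.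
  have abD : dot (f x1 - f x0) (x1 - x0) <= D.
    by rewrite (le_trans (ler_norm _))// HC.
  set a := dot _ (x - x0) in ab *; set b := dot _ (x - x1) in ab *.
  rewrite -mulrN => G0 G1.
  have a0 : 0 < a.
    rewrite ltNge; apply/negP => a0; have : t * a <= 0 by rewrite mulr_ge0_le0.
    by rewrite leNgt => /negP; apply;
      rewrite (lt_le_trans _ G0)// mulr_gt0// (lt_le_trans ltr01).
  have b0 : b < 0.
    rewrite ltNge; apply/negP => b0.
    have : (1 - t) * - b <= 0 by rewrite mulr_ge0_le0 ?subr_ge0// oppr_le0.
    by rewrite leNgt => /negP; apply;
      rewrite (lt_le_trans _ G1)// mulr_gt0// (lt_le_trans ltr01).
  have : c0 * `|x - x0| <= D.
    have := ler_piMl (ltW a0) t1; lra.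
  rewrite -ler_pdivlMl// mulrC => xD; rewrite /r; have := normr_ge0 (x1 - x0); lra.
move=> s01.
pose K := [set x : V | `|x - x0| <= r].
have cK : compact K.
  apply: bounded_closed_compact.
    exists (r + `|x0|); split; first exact: num_real.
    move=> M rM x /= xK; rewrite -(subrK x0 x) (le_trans (ler_normD _ _))//.
    by rewrite (le_trans _ (ltW rM))// lerD2r.
  have c x : {for x, continuous (fun x : V => `|x - x0|)}.
    have c : {for x, continuous (fun x : V => x - x0)}.
      by apply: continuous_sub; [exact: continuous_self|exact: continuous_const].
    exact: (continuous_comp c (@norm_continuous _ _ _)).
  exact: (closed_comp (fun x _ => c x) (@closed_le R r)).
pose I := `[0 : R, 1]%classic `&` y @^-1` (range f).
suff IE : I = `[0, 1]%classic.
  have : I s by rewrite IE /= in_itv.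
  by move=> [_ [x _ fx]]; exists x.
apply: (@segment_connected R 0 1).
- exists 0; split; first by rewrite /= in_itv /= lexx ler01.
  by exists x0 => //; rewrite /y scale0r addr0.
- exists (y @^-1` range f) => //; apply: open_comp => [t _|]; first exact: cy.
  rewrite openE => _ [x _ <-].
  by apply: filterS (monotone_locally_onto x ltr01) => z [x' _ <-]; exists x'.
- exists (y @^-1` (f @` K)).
    apply: closed_comp => [t _|]; first exact: cy.
    apply: compact_closed; first exact: norm_hausdorff.
    by apply: continuous_compact => //; exact: continuous_subspaceT.
  apply/seteqP; split=> t [t01 [x Kx fx]]; split=> //; last by exists x.
  exists x => //; apply: bnd fx; move: t01; by rewrite /= in_itv.
Qed.

End MonotoneInverse.

(** * Smooth dependence of the inverse matrix *)

Section SmoothInvmx.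
Context {R : realType} {E : normedModType R}.

Lemma Ck_on_det k n (O : set E) (A : E -> 'M[R]_n) : open O ->
  (forall i j, Ck_on k O (fun x => A x i j)) -> Ck_on k O (fun x => \det (A x)).
Proof.
move=> oO CA; apply: Ck_on_sum => // s; apply: Ck_onM => //; first exact: Ck_on_cst.
exact: Ck_on_prod.
Qed.

(** Cramer's rule: each entry is a cofactor divided by the determinant. *)
Lemma Ck_on_invmx k n (O : set E) (A : E -> 'M[R]_n) i j : open O ->
  (forall x, O x -> A x \in unitmx) ->
  (forall i j, Ck_on k O (fun x => A x i j)) -> Ck_on k O (fun x => invmx (A x) i j).
Proof.
move=> oO uA CA.
have C : Ck_on k O (fun x => (\det (A x))^-1 * cofactor (A x) j i).
  apply: Ck_onM => //.
    apply: Ck_onV => //; last exact: Ck_on_det.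
    by move=> x Ox; rewrite -unitfE; have := uA _ Ox; rewrite unitmxE.
  apply: Ck_onM => //; first exact: Ck_on_cst.
  apply: Ck_on_det => // i' j'.
  apply: (Ck_on_ext oO _ (CA (lift j i') (lift i j'))) => x _.
  by rewrite !mxE.
by apply: (Ck_on_ext oO _ C) => x Ox; rewrite /invmx uA// !mxE.
Qed.

End SmoothInvmx.

(** * Smoothness of the inverse of a map with positive definite derivative *)

Section Inverse.
Context {R : realType} {k : nat}.
Local Notation V := 'rV[R]_k.
Variable f : V -> V.
Hypothesis Cf : smooth_on setT f.
Hypothesis fpos : forall x v : V, v != 0 -> 0 < dot ('D_v f x) v.

Let df x : differentiable f x.
Proof. exact: (Cf 1).1. Qed.

Definition inverse_fun (g : V -> V) (y : V) : V := xget 0 [set x | g x = y].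
Local Notation g := (inverse_fun f).

Lemma inverse_funK x : g (f x) = x.
Proof.
apply: (strictly_monotone_injective Cf fpos).
by rewrite (@xgetPex _ 0 [set x' | f x' = f x]) //; exists x.
Qed.

Lemma range_monotone_open : open (range f).
Proof.
rewrite openE => _ [x _ <-].
by apply: filterS (monotone_locally_onto Cf fpos x ltr01) => z [x' _ <-]; exists x'.
Qed.

Let J x := jacobian f x.

Let derive_J x v : 'D_v f x = v *m J x.
Proof. exact: deriveEjacobian. Qed.

Let J_unit x : J x \in unitmx.
Proof.
rewrite -row_free_unit -kermx_eq0; apply/eqP/row_matrixP => i; rewrite row0.
apply/eqP/negPn/negP => v0; have := fpos x v0.
by rewrite derive_J -row_mul mulmx_ker row0 dot0l ltxx.
Qed.

(** Write [f x + h = f x'] and [d = x' - x]. Then [h] equals [d *m J x] up to [eta |d|], and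
    applying [l], which inverts [J x] and has Lipschitz constant [K], gives
    [|l h - d| <= K eta |d|]. *)
Lemma is_diff_inverse_fun x :
  is_diff (f x) g (mulmxr (invmx (J x)) : {linear V -> V}).
Proof.
set l := mulmxr _; have cl : continuous l by exact: continuous_mulmxr.
apply: differentiable_epsP => // e e0.
have [K K0 lK] := linear_lipschitz cl.
(* The first bound makes the error at most [|d| / 2], whence [|d| <= 2 K |h|]; with this, the second
   bound makes the error at most [e |h|]. *)
pose eta := Num.min (1 / (2 * K)) (e / (2 * K ^+ 2)).
have eta0 : 0 < eta by rewrite lt_min !divr_gt0// mulr_gt0// exprn_gt0.
have [r /= r0 rf] : exists2 r : R, 0 < r & forall d : V, `|d| < r ->
    `|f (d + x) - f x - d *m J x| <= eta * `|d|.
  have /nbhs_normP[r /= r0 rf] := differentiable_eps (df x) eta0.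
  exists r => // d dr; rewrite -derive_J deriveE//; apply: rf.
  by rewrite /ball_ /= sub0r normrN.
(* This gives the continuity of the inverse: points near [f x] have a preimage within [r] of [x]. *)
have := monotone_locally_onto Cf fpos x r0.
rewrite (near_shift 0) subr0; apply: filterS => h /= [x' xr fx'].
rewrite inverse_funK -fx' inverse_funK.
have := rf (x' - x) xr; rewrite subrK fx' addrK.
have lh : l (h - (x' - x) *m J x) = l h - (x' - x).
  by rewrite /l /= mulmxBl mulmxK.
have : `|l h - (x' - x)| <= K * `|h - (x' - x) *m J x| by rewrite -lh; exact: lK.
set d := x' - x; set rho := h - _; move=> A1 A2.
have A3 : `|l h - d| <= K * (eta * `|d|) by rewrite (le_trans A1)// ler_pM2l.
have A4 : K * (eta * `|d|) <= `|d| / 2.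
  have -> : `|d| / 2 = K * (1 / (2 * K) * `|d|) by field; rewrite gt_eqF.
  by rewrite ler_pM2l// ler_wpM2r// ge_min lexx.
have A5 : `|d| <= 2 * K * `|h|.
  have : `|d| <= `|l h| + `|l h - d|.
    by rewrite -{1}(subKr (l h) d) (le_trans (ler_normB _ _)).
  have := lK h; lra.
rewrite distrC (le_trans A3)// -[leRHS]mulr1.
have -> : e * `|h| * 1 = K * (e / (2 * K ^+ 2) * (2 * K * `|h|)) by field;
  rewrite gt_eqF.
rewrite ler_pM2l//; apply: ler_pM => //; first exact: ltW.
by rewrite ge_min lexx orbT.
Qed.

(** Bootstrapping: ['D_v g] is the smooth map [v *m invmx (J x)] evaluated at [g], so if [g] is of
    class C^n then so are its derivatives. *)
Lemma smooth_inverse_fun : smooth_on (range f) g.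
Proof.
have dg y : range f y -> differentiable g y.
  by move=> [x _ <-]; have [] := is_diff_inverse_fun x.
elim=> [y [x _ <-]|n IH].
  by apply: differentiable_continuous; apply: dg; exists x.
split=> // v.
have CJ i j : Ck_on n setT (fun x => J x i j).
  have Ci := (Cf n.+1).2 'e_i.
  have := (Ck_on_rowP n ('D_('e_i) f) openT).1 Ci j.
  apply: Ck_on_ext => [|x _]; first exact: openT.
  by rewrite derive_J -rowE mxE.
have C1 : Ck_on n setT (fun x => v *m invmx (J x)).
  apply/Ck_on_rowP => [|j]; first exact: openT.
  have C2 : Ck_on n setT (fun x => \sum_i v 0 i * invmx (J x) i j).
    apply: Ck_on_sum => [|i]; first exact: openT.
    apply: Ck_onM; [exact: openT|exact: Ck_on_cst|].
    by apply: Ck_on_invmx; first exact: openT.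
  by apply: (Ck_on_ext openT _ C2) => x _; rewrite mxE.
have C2 := Ck_on_comp range_monotone_open openT (fun _ _ => I) IH C1.
apply: (Ck_on_ext range_monotone_open _ C2).
move=> _ [x _ <-] /=; rewrite inverse_funK.
by rewrite (is_diff_derive _ (is_diff_inverse_fun x)).
Qed.

End Inverse.

(** * Smooth maps into manifolds *)

Section SmoothAt.
Context {R : realType}.
Implicit Types E F G : normedModType R.

Lemma near_open E (A : set E) x : (\near x, A x) -> exists O,
  [/\ open O, O x & O `<=` A].
Proof.
move=> Ax; exists (A^°); split; [exact: open_interior|by []|exact: interior_subset].
Qed.

Lemma is_diff_pairE E F G (f : E -> F) (g : E -> G) x :
  differentiable f x -> differentiable g x ->
  differentiable (fun y => (f y, g y)) x /\
  forall v, 'D_v (fun y => (f y, g y)) x = ('D_v f x, 'D_v g x).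
Proof.
move=> df dg; have d := differentiable_pair df dg; split=> // v.
by rewrite !deriveE // diff_pair.
Qed.

(** The pair is encoded as one row vector, to which [Ck_on_comp] applies; [h] is precomposed with
    the linear splitting [A] of that row vector. *)
Lemma Ck_on_comp2 E a b p k (O : set E) (O' : set ('rV[R]_a * 'rV[R]_b))
    (f : E -> 'rV[R]_a) (g : E -> 'rV[R]_b) (h : 'rV[R]_a * 'rV[R]_b -> 'rV[R]_p) :
  open O -> open O' -> (forall x, O x -> O' (f x, g x)) ->
  Ck_on k O f -> Ck_on k O g -> Ck_on k O' h -> Ck_on k O (fun x => h (f x, g x)).
Proof.
move=> oO oO' fgO Cf Cg Ch.
pose A (z : 'rV[R]_(a + b)) := (lsubmx z, rsubmx z).
have dA z : is_diff z A A.
  have lA : linear A by move=> c u w; rewrite /A !linearP.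
  pose AM := GRing.isLinear.Build _ _ _ _ _ lA.
  pose AL : {linear _ -> _} := HB.pack A AM.
  have cAL : continuous AL.
    by move=> w;
      exact:
        (cvg_pair (@continuous_lsubmx _ _ _ _ w) (@continuous_rsubmx _ _ _ _ w)).
  have := @differentiableP R _ _ AL z (linear_differentiable _ cAL).
  by rewrite (diff_lin _ cAL).
have cA : continuous A by move=> z; apply: differentiable_continuous; case: (dA z).
have oA : open (A @^-1` O') by apply: open_comp => // z _; exact: cA.
have C1 := Ck_on_comp_affine oO' dA Ch.
have C2 : Ck_on k O (fun x => row_mx (f x) (g x)).
  apply/Ck_on_rowP => // j; case: (split_ordP j) => i ->.
    apply: (Ck_on_ext oO _ ((Ck_on_rowP k f oO).1 Cf i)) => x _.
    by rewrite row_mxEl.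
  apply: (Ck_on_ext oO _ ((Ck_on_rowP k g oO).1 Cg i)) => x _.
  by rewrite row_mxEr.
have e x : A (row_mx (f x) (g x)) = (f x, g x) by rewrite /A row_mxKl row_mxKr.
have fA x : O x -> (A @^-1` O') (row_mx (f x) (g x)) by move=> /fgO; rewrite /= e.
apply: (Ck_on_ext oO _ (Ck_on_comp oO oA fA C2 C1)) => x _ /=.
by rewrite e.
Qed.

(* The relations [P] and [Q] on directions express the Cauchy-Riemann equations
   when they are the graphs of complex structures; for [P = set0] only
   smoothness near [y] is left. *)
Definition smooth_at E F (P : set (E * E)) (Q : set (F * F)) (f : E -> F) (y : E) :=
  exists O, [/\ open O, O y, smooth_on O f &
    forall x v w, O x -> P (v, w) -> Q ('D_v f x, 'D_w f x)].

Lemma smooth_at_near_eq E F P Q (f g : E -> F) y :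
  (\near y, f y = g y) -> smooth_at P Q f y -> smooth_at P Q g y.
Proof.
move=> /near_open[ O1 [oO1 O1y fg]] [ O [oO Oy Cf Pf]].
have oI := openI oO1 oO; exists (O1 `&` O); split=> // [k|x v w [ O1x Ox] Pvw].
  apply: (Ck_on_ext oI (f := f)); first by move=> x [/fg].
  by apply: Ck_on_sub (Cf k) => x [].
have e u : 'D_u f x = 'D_u g x by apply: near_eq_derive;
  exact: (open_near_eq oO1 O1x).
by rewrite -(e v) -(e w); exact: Pf.
Qed.

Lemma smooth_at_continuous E F P Q (f : E -> F) y :
  smooth_at P Q f y -> {for y, continuous f}.
Proof. by move=> [ O [_ Oy Cf _]]; exact: (Cf 0 y Oy). Qed.

Lemma smooth_at_differentiable E F P Q (f : E -> F) y :
  smooth_at P Q f y -> differentiable f y.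
Proof. by move=> [ O [_ Oy Cf _]]; exact: ((Cf 1).1 y Oy). Qed.

Lemma smooth_at_near E F P Q (f : E -> F) y :
  smooth_at P Q f y -> \near y, smooth_at P Q f y.
Proof.
move=> [ O [oO Oy Cf Pf]]; apply: filterS (open_nbhs_nbhs (conj oO Oy)) => x Ox.
by exists O.
Qed.

Lemma smooth_at_derive E F P Q (f : E -> F) v y :
  smooth_at P Q f y -> smooth_at set0 setT ('D_v f) y.
Proof.
by move=> [ O [oO Oy Cf _]]; exists O; split=> // k; exact: (Cf k.+1).2.
Qed.

Lemma smooth_at_weaken E F P Q Q' (f : E -> F) y :
  smooth_at P Q f y -> smooth_at set0 Q' f y.
Proof. by move=> [ O [oO Oy Cf _]]; exists O. Qed.

Lemma smooth_at_cst E F (P : set (E * E)) (Q : set (F * F)) (a : F) y : Q (0, 0) ->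
  smooth_at P Q (fun _ => a) y.
Proof.
move=> Q0; exists setT; split=> // [|k|x v w _ _]; first exact: openT.
  exact: Ck_on_cst.
by rewrite !derive_cst.
Qed.

Lemma smooth_at_comp E n p P Q S (f : E -> 'rV[R]_n) (g : 'rV[R]_n -> 'rV[R]_p) y :
  smooth_at P Q f y -> smooth_at Q S g (f y) -> smooth_at P S (g \o f) y.
Proof.
move=> sf [ O' [oO' O'y Cg Qg]]; have [ O [oO Oy Cf Pf]] := sf.
have /near_open[ O1 [oO1 O1y fO1]] : \near y, O' (f y).
  by apply: (smooth_at_continuous sf); exact: open_nbhs_nbhs.
have oI := openI oO1 oO; exists (O1 `&` O); split=> // [k|x v w [ O1x Ox] Pvw].
  apply: (Ck_on_comp oI oO' _ _ (Cg k)); first by move=> x [/fO1].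
  by apply: Ck_on_sub (Cf k) => x [].
have df := (Cf 1).1 x Ox; have dg := (Cg 1).1 _ (fO1 _ O1x).
by rewrite (derive_comp v df dg) (derive_comp w df dg); apply: Qg;
  [exact: fO1|exact: Pf].
Qed.

Lemma smooth_at_comp2 E a b p P Q1 Q2 Q S (f : E -> 'rV[R]_a) (g : E -> 'rV[R]_b)
    (h : 'rV[R]_a * 'rV[R]_b -> 'rV[R]_p) y :
  (forall v1 v2 w1 w2, Q1 (v1, w1) -> Q2 (v2, w2) -> Q ((v1, v2), (w1, w2))) ->
  smooth_at P Q1 f y -> smooth_at P Q2 g y -> smooth_at Q S h (f y, g y) ->
  smooth_at P S (fun x => h (f x, g x)) y.
Proof.
move=> Q12 sf sg [ O' [oO' O'y Ch Qh]].
have [ O [oO Oy Cf Pf]] := sf; have [ O2 [oO2 O2y Cg Pg]] := sg.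
have /near_open[ O1 [oO1 O1y fO1]] : \near y, O' (f y, g y).
  have c : {for y, continuous (fun y => (f y, g y))}.
    exact: (continuous_pair (smooth_at_continuous sf) (smooth_at_continuous sg)).
  by apply: c; exact: open_nbhs_nbhs.
have oI := openI oO1 (openI oO oO2); exists (O1 `&` (O `&` O2)).
split=> // [k|x v w [ O1x [ Ox O2x]] Pvw].
  apply: (Ck_on_comp2 oI oO' _ _ _ (Ch k)); first by move=> x [/fO1].
    by apply: Ck_on_sub (Cf k) => x [_ []].
  by apply: Ck_on_sub (Cg k) => x [_ []].
have df := (Cf 1).1 x Ox; have dg := (Cg 1).1 x O2x.
have [dfg e] := is_diff_pairE df dg; have dh := (Ch 1).1 _ (fO1 _ O1x).
have eh u : 'D_u (fun x => h (f x, g x)) x = 'D_('D_u f x, 'D_u g x) h (f x, g x).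
  by rewrite -e; exact: (derive_comp u dfg dh).
rewrite (eh v) (eh w); apply: Qh; first exact: fO1.
by apply: Q12; [exact: Pf|exact: Pg].
Qed.

Lemma is_diff_fst E F (p : E * F) : is_diff p (fun q => q.1) (fun q => q.1).
Proof.
have lA : linear (fun q : (E * F)%type => q.1) by [].
pose A : {linear (E * F)%type -> E} :=
  HB.pack (fun q : (E * F)%type => q.1) (GRing.isLinear.Build _ _ _ _ _ lA).
have cA : continuous A by move=> q; exact: cvg_fst.
have := @differentiableP R _ _ A p (linear_differentiable _ cA).
by rewrite (diff_lin _ cA).
Qed.

Lemma is_diff_snd E F (p : E * F) : is_diff p (fun q => q.2) (fun q => q.2).
Proof.
have lA : linear (fun q : (E * F)%type => q.2) by [].
pose A : {linear (E * F)%type -> F} :=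
  HB.pack (fun q : (E * F)%type => q.2) (GRing.isLinear.Build _ _ _ _ _ lA).
have cA : continuous A by move=> q; exact: cvg_snd.
have := @differentiableP R _ _ A p (linear_differentiable _ cA).
by rewrite (diff_lin _ cA).
Qed.

Lemma smooth_at_id E (P : set (E * E)) y : smooth_at P P (fun x => x) y.
Proof.
exists setT; split=> // [|k|x v w _]; [exact: openT|exact: Ck_on_id|].
have e u : 'D_u (fun x : E => x) x = u by exact: derive_id.
by rewrite (e v) (e w).
Qed.

Lemma smooth_at_linear E F (f : E -> F) y : (forall x, is_diff x f f) ->
  smooth_at set0 setT f y.
Proof.
move=> df; exists setT; split=> //; first exact: openT.
move=> k; exact: (Ck_on_comp_affine openT df (Ck_on_id k setT)).
Qed.

Lemma smooth_at_scale E n (r : E -> R) (X : 'rV[R]_n) y :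
  smooth_at set0 setT r y -> smooth_at set0 setT (fun x => r x *: X) y.
Proof.
move=> [ O [oO Oy Cr _]]; exists O; split=> // k; apply/Ck_on_rowP => // j.
apply: (Ck_on_ext oO _ (Ck_onM oO (Cr k) (Ck_on_cst k O (X 0 j)))) => x _.
by rewrite mxE.
Qed.

Lemma derive_fst (E F G : normedModType R) (f : E * F -> G) a b v :
  'D_v (fun x => f (x, b)) a = 'D_(v, 0) f (a, b).
Proof.
have e :
  (fun h : R => h^-1 *: (((fun x => f (x, b)) \o shift a) (h *: v) - f (a, b))) =
    (fun h => h^-1 *: ((f \o shift (a, b)) (h *: (v, 0)) - f (a, b))).
  apply/funext => h /=; congr (_ *: (f _ - _)).
  by congr (_, _); rewrite /= scaler0 add0r.
by rewrite /derive e.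
Qed.

Lemma derive_snd (E F G : normedModType R) (f : E * F -> G) a b v :
  'D_v (fun x => f (a, x)) b = 'D_(0, v) f (a, b).
Proof.
have e :
  (fun h : R => h^-1 *: (((fun x => f (a, x)) \o shift b) (h *: v) - f (a, b))) =
    (fun h => h^-1 *: ((f \o shift (a, b)) (h *: (0, v)) - f (a, b))).
  apply/funext => h /=; congr (_ *: (f _ - _)).
  by congr (_, _); rewrite /= scaler0 add0r.
by rewrite /derive e.
Qed.

End SmoothAt.

Section Chart.
Context {R : realType} {T : topologicalType} {E : normedModType R}.
Variable c : chart T E.

Lemma chart_dom_near (U : topologicalType) (f : U -> T) y :
  {for y, continuous f} -> cdom c (f y) -> \near y, cdom c (f y).
Proof.
by move=> cf cfy; apply: cf; apply: open_nbhs_nbhs; split=> //; exact: cdom_open.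
Qed.

Lemma chart_img (x : T) : cdom c x -> (c @` cdom c) (c x).
Proof. by exists x. Qed.

Lemma chart_img_near (x : T) : cdom c x -> \forall z \near c x, (c @` cdom c) z.
Proof.
by move=> cx; apply: open_nbhs_nbhs; split; [exact: cimg_open|exact: chart_img].
Qed.

Lemma cinv_dom y : (c @` cdom c) y -> cdom c (cinv c y) /\ c (cinv c y) = y.
Proof. by move=> [x cx <-]; rewrite cfunK. Qed.

Lemma continuous_through_chart (U : topologicalType) (f : T -> U) (x : T) :
  cdom c x -> {for c x, continuous (f \o cinv c)} -> {for x, continuous f}.
Proof.
move=> cx cf; have := continuous_comp (cfun_continuous cx) cf.
rewrite /prop_for /continuous_at /= cfunK// => h.
apply: cvg_trans h; apply: near_eq_cvg.
apply: filterS (open_nbhs_nbhs (conj (cdom_open c) cx)) => y cy.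
by rewrite /= cfunK.
Qed.

Lemma chart_overlap_open (A : set T) : open A -> open (c @` (cdom c `&` A)).
Proof.
move=> oA; rewrite openE => _ [x [cx Ax] <-].
have ci := cinv_continuous (chart_img cx).
have nA : \forall z \near c x, A (cinv c z).
  by apply: ci; apply: open_nbhs_nbhs; rewrite cfunK.
apply: filterS (filterI nA (chart_img_near cx)) => y [Ay /cinv_dom[cy e]].
by exists (cinv c y).
Qed.

End Chart.

(** * Smooth and holomorphic maps into a complex manifold *)

Section SmoothIntoManifold.
Context {R : realType}.
Implicit Types E : normedModType R.

Definition ci_graph n : set ('rV[R]_(n + n) * 'rV[R]_(n + n)) :=
  [set p | p.2 = muli p.1].

Lemma ci_graphE n (v w : 'rV[R]_(n + n)) : ci_graph (v, w) = (w = muli v).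
Proof. by []. Qed.

(** Continuity is demanded separately: [c] is a total function that is meaningful only on [cdom c],
    so smoothness of [c \o f] does not keep [f] inside the chart near [y]. *)
Definition msmooth n (X : complex_manifold R n) E (P : set (E * E)) (f : E -> X) y :=
  {for y, continuous f} /\
  exists c : chart X 'rV[R]_(n + n),
    [/\ atlas c, cdom c (f y) & smooth_at P (@ci_graph n) (c \o f) y].

Lemma holo_on_smooth_at n p (O : set 'rV[R]_(n + n))
  (f : 'rV[R]_(n + n) -> 'rV[R]_(p + p)) y :
  open O -> O y -> holo_on (@muli R n) (@muli R p) O f ->
  smooth_at (@ci_graph n) (@ci_graph p) f y.
Proof.
by move=> oO Oy [Cf Hf]; exists O; split=> // x v w Ox; rewrite !ci_graphE => ->;
  exact: Hf.
Qed.

Lemma transition_smooth_at n (X : complex_manifold R n)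
  (c d : chart X 'rV[R]_(n + n)) x :
  atlas c -> atlas d -> cdom c x -> cdom d x ->
  smooth_at (@ci_graph n) (@ci_graph n) (d \o cinv c) (c x).
Proof.
move=> ac ad cx dx; apply: holo_on_smooth_at (atlas_holo ac ad).
  exact/chart_overlap_open/cdom_open.
by exists x.
Qed.

(** Independence of the chart: transition maps are holomorphic, hence preserve both smoothness and
    the Cauchy-Riemann relation. *)
Lemma msmooth_chart n (X : complex_manifold R n) E P (f : E -> X) y :
  msmooth P f y -> forall d, atlas d -> cdom d (f y) ->
    smooth_at P (@ci_graph n) (d \o f) y.
Proof.
move=> [cf [c [ac cy sc]]] d ad dy.
have h := smooth_at_comp sc (transition_smooth_at ac ad cy dy).
apply: smooth_at_near_eq h; apply: filterS (chart_dom_near cf cy) => x cx /=.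
by rewrite cfunK.
Qed.

Lemma msmooth_cst n (X : complex_manifold R n) E P (a : X) (y : E) :
  msmooth P (fun _ => a) y.
Proof.
split; first exact: cvg_cst.
have [c ac ca] := atlas_cover a; exists c; split=> //.
apply: smooth_at_cst; by rewrite ci_graphE /muli mul0mx.
Qed.

Lemma msmooth_cinv n (X : complex_manifold R n) (c : chart X 'rV[R]_(n + n)) y :
  atlas c -> (c @` cdom c) y -> msmooth (@ci_graph n) (cinv c) y.
Proof.
move=> ac cy; split; first exact: cinv_continuous.
have [cx _] := cinv_dom cy; exists c; split=> //.
case: cy cx => x cx <- _; exact: transition_smooth_at.
Qed.

Lemma msmooth_comp n (X : complex_manifold R n) E k P Q (f : E -> 'rV[R]_k)
    (g : 'rV[R]_k -> X) y :
  smooth_at P Q f y -> msmooth Q g (f y) -> msmooth P (g \o f) y.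
Proof.
move=> sf [cg [c [ac cy sc]]]; split.
  by apply: continuous_comp cg; exact: smooth_at_continuous sf.
exists c; split=> //; exact: smooth_at_comp sf sc.
Qed.

Lemma msmooth_of_chart n (X : complex_manifold R n) E P (f : E -> X) y
    (d : chart X 'rV[R]_(n + n)) (h : E -> 'rV[R]_(n + n)) :
  atlas d -> (\near y, cdom d (f y) /\ d (f y) = h y) ->
  smooth_at P (@ci_graph n) h y -> msmooth P f y.
Proof.
move=> ad fh sh; have [dy e] := nbhs_singleton fh; split.
  have ch : {for y, continuous (cinv d \o h)}.
    apply: continuous_comp (smooth_at_continuous sh) _.
    by apply: cinv_continuous; rewrite -e; exists (f y).
  have e' : \near y, cinv d (h y) = f y.
    by apply: filterS fh => x [dx <-]; rewrite cfunK.
  rewrite /prop_for /continuous_at -(nbhs_singleton e').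
  by apply: cvg_trans ch; apply: near_eq_cvg.
exists d; split; [exact: ad|exact: dy|].
apply: smooth_at_near_eq sh.
by apply: filterS fh => x [_ <-].
Qed.

Lemma msmooth_map2 a b n (X1 : complex_manifold R a) (X2 : complex_manifold R b)
    (X : complex_manifold R n) (F : X1 -> X2 -> X) E P (f : E -> X1) (g : E -> X2)
      y :
  holo_map2 F -> msmooth P f y -> msmooth P g y ->
    msmooth P (fun x => F (f x) (g x)) y.
Proof.
move=> hF sf sg.
have [c [d [W [h]]]] := hF (f y, g y) I.
move=> [[[c1 [c2 [ac1 ac2 ec]]] cfg ad dF] [oW Wc] [Ch Hh] Fh].
rewrite {}ec in cfg Wc Fh; have [c1f c2g] := cfg.
have s1 := msmooth_chart sf ac1 c1f; have s2 := msmooth_chart sg ac2 c2g.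
have sh : smooth_at [set p | p.2 = (muli p.1.1, muli p.1.2)] (@ci_graph n) h
    (c1 (f y), c2 (g y)).
  by exists W; split=> // x v [w1 w2] Wx /= -[-> ->]; exact: Hh.
have := smooth_at_comp2 _ s1 s2 sh.
move=> S; apply: (msmooth_of_chart ad _ (S _)) => [|v1 v2 w1 w2];
  last by rewrite !ci_graphE => -> ->.
have cc : {for y, continuous (fun y => (c1 (f y), c2 (g y)))}.
  exact: (continuous_pair (smooth_at_continuous s1) (smooth_at_continuous s2)).
have nW : \near y, W (c1 (f y), c2 (g y)) by apply: cc; exact: open_nbhs_nbhs.
apply:
  filterS
    (filterI (chart_dom_near sf.1 c1f) (filterI (chart_dom_near sg.1 c2g) nW)) =>
      x [c1x [c2x Wx]].
exact: (Fh (f x, g x) I).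
Qed.

Lemma msmooth_map1 a n (X1 : complex_manifold R a) (X : complex_manifold R n)
    (F : X1 -> X) E P (f : E -> X1) y :
  holo_map F -> msmooth P f y -> msmooth P (fun x => F (f x)) y.
Proof.
move=> hF sf; have [c [d [W [h]]]] := hF (f y) I.
move=> [[ac cf ad dF] [oW Wc] Hh Fh].
have s1 := msmooth_chart sf ac cf.
apply: (msmooth_of_chart ad _ (smooth_at_comp s1 (holo_on_smooth_at oW Wc Hh))).
have nW : \near y, W (c (f y)).
  by apply: (smooth_at_continuous s1); exact: open_nbhs_nbhs.
apply: filterS (filterI (chart_dom_near sf.1 cf) nW) => x [cx Wx].
exact: (Fh (f x) I).
Qed.

Lemma msmooth_weaken n (X : complex_manifold R n) E P (f : E -> X) y :
  msmooth P f y -> msmooth set0 f y.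
Proof.
move=> [cf [c [ac cy sc]]]; split=> //; exists c; split=> //.
exact: smooth_at_weaken sc.
Qed.

Lemma msmooth_flat n (X : complex_manifold R n) k (f : 'rV[R]_k -> X) y :
  smooth_map (flat_atlas 'rV[R]_k) (@atlas R n X) setT f -> msmooth set0 f y.
Proof.
move=> sf; have [c [d [W [h]]]] := sf y I.
move=> [[ec cy ad dy] [oW Wy] Ch fh]; rewrite {}ec in cy Wy fh.
apply: (msmooth_of_chart ad (h := h)).
  by apply: filterS (open_nbhs_nbhs (conj oW Wy)) => x Wx; exact: fh.
by exists W; split.
Qed.

Lemma smooth_at_map_flat n (X : complex_manifold R n) k (f : X -> 'rV[R]_k) E
    (g : E -> X) y : smooth_map (@atlas R n X) (flat_atlas 'rV[R]_k) setT f ->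
  msmooth set0 g y -> smooth_at set0 setT (f \o g) y.
Proof.
move=> sf sg; have [c [d [W [h]]]] := sf (g y) I.
move=> [[ac cy ed dy] [oW Wy] Ch fh]; rewrite {}ed in dy fh.
have s1 := msmooth_chart sg ac cy.
have sh : smooth_at (@ci_graph n) setT h (c (g y)) by exists W; split.
have := smooth_at_comp s1 sh; apply: smooth_at_near_eq.
have nW : \near y, W (c (g y)).
  by apply: (smooth_at_continuous s1); exact: open_nbhs_nbhs.
apply: filterS (filterI (chart_dom_near sg.1 cy) nW) => x [cx Wx] /=.
by have [_ <-] := fh _ I cx Wx.
Qed.

Lemma smooth_map_continuous n (X : complex_manifold R n) k (f : X -> 'rV[R]_k) :
  smooth_map (@atlas R n X) (flat_atlas 'rV[R]_k) setT f -> continuous f.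
Proof.
move=> sf x; have [c ac cx] := atlas_cover x.
have sx := msmooth_cinv ac (chart_img cx).
have sx0 := msmooth_weaken sx.
exact:
  (continuous_through_chart cx (smooth_at_continuous (smooth_at_map_flat sf sx0))).
Qed.

Lemma derive_through_chart n (X : complex_manifold R n) (c : chart X 'rV[R]_(n + n))
    (G : normedModType R) (phi : X -> G) E (f : E -> X) y v :
  {for y, continuous f} -> cdom c (f y) -> differentiable (c \o f) y ->
  differentiable (phi \o cinv c) (c (f y)) ->
  'D_v (phi \o f) y = 'D_('D_v (c \o f) y) (phi \o cinv c) (c (f y)).
Proof.
move=> cf cy dcf dphi; rewrite -(derive_comp v dcf dphi).
apply: near_eq_derive; apply: filterS (chart_dom_near cf cy) => x cx /=.
by rewrite cfunK.
Qed.

(** The set where [f] takes the value [f 0] is closed since the manifold is Hausdorff, and open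
    since near each of its points the coordinates have zero derivative; the line is connected. The
    chart may depend on [t], so a velocity can be computed in any convenient chart. *)
Lemma constant_of_null_velocity n (X : complex_manifold R n) (f : R -> X) (t : R) :
  (forall t, msmooth set0 f t) ->
  (forall t, exists c : chart X 'rV[R]_(n + n),
     [/\ atlas c, cdom c (f t) & 'D_1 (c \o f) t = 0]) ->
  f t = f 0.
Proof.
move=> sf vf.
have cf : continuous f by move=> s; exact: (sf s).1.
pose B := [set s | f s = f 0].
suff -> : B t by []; suff -> : B = setT by [].
apply: (connected_intervalP setT).2.
- by move=> ? ? ? ? ? ?.
- by exists 0.
- exists B; last by rewrite setTI.
  rewrite openE => s Bs; have [c [ac cs _]] := vf s.
  have [e /= e0 He] := (nbhs_normP _ _).1 (chart_dom_near (cf s) cs).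
  apply/nbhs_normP; exists e => // s' ss'.
  have dc r : `|r - s| <= `|s' - s| -> is_derive r 1 (c \o f) 0.
    move=> rs; have cr : cdom c (f r).
      by apply: He; rewrite /ball_ /= distrC (le_lt_trans rs)// distrC.
    have sr := msmooth_chart (sf r) ac cr.
    apply: DeriveDef; first exact/diff_derivable/(smooth_at_differentiable sr).
    (* The velocity at [r] is known to vanish in some chart [d]; the differential of the transition
       map carries this over to [c]. *)
    have [d [ad dr e']] := vf r.
    rewrite (derive_through_chart _ (cf r) dr); first last.
    - exact: smooth_at_differentiable (transition_smooth_at ad ac dr cr).
    - exact: smooth_at_differentiable (msmooth_chart (sf r) ad dr).
    by rewrite e' derive0.
  have cs' : cdom c (f s') by exact: He.
  rewrite /B /= -[RHS]Bs -[LHS](cfunK cs') -[RHS](cfunK cs); congr (cinv c _).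
  apply/rowP => j.
  apply: (@derive_line_eq0 R (fun r => c (f r) 0 j)) => r rs; have [d e1] := dc r rs.
  apply: DeriveDef; first exact: ((derivable_mxP _ _ _).1 d 0 j).
  by rewrite -(derive_row j d) e1 mxE.
- exists B; last by rewrite setTI.
  apply: (@closed_comp _ _ f [set f 0]) => [s _|]; first exact: cf.
  exact/accessible_closed_set1/hausdorff_accessible/cm_hausdorff.
Qed.

End SmoothIntoManifold.

(** * One-parameter subgroups and the bracket *)

Section LieGroup.
Context {R : realType} {n : nat} (H : complex_lie_group R n).
Local Notation L := 'rV[R]_(n + n).
Local Notation c1 := (@chart1 R n H).
Local Notation one := (@lone R n H).
Local Notation e := (c1 one).

Lemma lmulVr (x : H) : lmul x (linv x) = one.
Proof.
rewrite -[lmul x _]lmul1 -{1}(lmulV (linv x)) -lmulA (lmulA (linv x)).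
by rewrite lmulV lmul1 lmulV.
Qed.

Lemma lmulr1 (x : H) : lmul x one = x.
Proof. by rewrite -(lmulV x) lmulA lmulVr lmul1. Qed.

Lemma lmulI (g x y : H) : lmul g x = lmul g y -> x = y.
Proof. by move=> h; rewrite -[x]lmul1 -[y]lmul1 -(lmulV g) -!lmulA h. Qed.

Lemma linv_eq (x y : H) : lmul x y = one -> linv x = y.
Proof. by move=> h; apply: (@lmulI x); rewrite lmulVr. Qed.

Lemma msmooth_mul (E : normedModType R) P (f g : E -> H) y :
  msmooth P f y -> msmooth P g y -> msmooth P (fun x => lmul (f x) (g x)) y.
Proof. exact/msmooth_map2/lmul_holo. Qed.

Lemma msmooth_inv (E : normedModType R) P (f : E -> H) y :
  msmooth P f y -> msmooth P (fun x => linv (f x)) y.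
Proof. exact/msmooth_map1/linv_holo. Qed.

Lemma chart1_img : (c1 @` cdom c1) e.
Proof. by apply: chart_img; exact: chart1_dom. Qed.

Lemma cinv1 : cinv c1 e = one.
Proof. by rewrite cfunK//; exact: chart1_dom. Qed.

(** The multiplication read in the chart at the unit. The chart is not assumed to be centred, so the
    unit has coordinates [e] and derivatives are taken at [(e, e)]. *)
Definition mulc (p : L * L) : L := c1 (lmul (cinv c1 p.1) (cinv c1 p.2)).

Lemma msmooth_cinv_fst : msmooth set0 (fun p : L * L => cinv c1 p.1) (e, e).
Proof.
apply: (msmooth_comp (Q := set0) (f := fun p : L * L => p.1)).
  by apply: smooth_at_weaken; apply: smooth_at_linear => p; exact: is_diff_fst.
by apply: msmooth_weaken; apply: msmooth_cinv;
  [exact: chart1_atlas|exact: chart1_img].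
Qed.

Lemma msmooth_cinv_snd : msmooth set0 (fun p : L * L => cinv c1 p.2) (e, e).
Proof.
apply: (msmooth_comp (Q := set0) (f := fun p : L * L => p.2)).
  by apply: smooth_at_weaken; apply: smooth_at_linear => p; exact: is_diff_snd.
by apply: msmooth_weaken; apply: msmooth_cinv;
  [exact: chart1_atlas|exact: chart1_img].
Qed.

Lemma smooth_mulc : smooth_at set0 setT mulc (e, e).
Proof.
have := msmooth_chart (msmooth_mul msmooth_cinv_fst msmooth_cinv_snd)
  (chart1_atlas H).
rewrite /= cinv1 lmul1 => /(_ (chart1_dom H)); exact: smooth_at_weaken.
Qed.

Lemma near_cdom1 : \forall a \near e, cdom c1 (cinv c1 a) /\ c1 (cinv c1 a) = a.
Proof. by apply: filterS (chart_img_near (chart1_dom H)) => a; exact: cinv_dom. Qed.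

Lemma mulc1 a : c1 (cinv c1 a) = a -> mulc (a, e) = a /\ mulc (e, a) = a.
Proof. by move=> ea; rewrite /mulc /= cinv1 lmulr1 lmul1. Qed.

(** Fixing either argument at [e] leaves the identity near [e], so both partial differentials are
    the identity. *)
Lemma derive_mulc v w : 'D_(v, w) mulc (e, e) = v + w.
Proof.
have dm := smooth_at_differentiable smooth_mulc.
have -> : (v, w) = (v, 0) + (0, w) :> L * L by congr (_, _);
  rewrite /= ?addr0 ?add0r.
rewrite deriveE // linearD -!deriveE // -derive_fst -derive_snd.
congr (_ + _); rewrite -[RHS](derive_id e); apply: near_eq_derive;
  by apply: filterS near_cdom1 => a [_ /mulc1[]].
Qed.

Lemma derive_mul (f g : R -> H) : msmooth set0 f 0 -> msmooth set0 g 0 ->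
  f 0 = one -> g 0 = one ->
  'D_1 (fun t => c1 (lmul (f t) (g t))) 0 = 'D_1 (c1 \o f) 0 + 'D_1 (c1 \o g) 0.
Proof.
move=> sf sg f0 g0.
have cf : cdom c1 (f 0) by rewrite f0; exact: chart1_dom.
have cg : cdom c1 (g 0) by rewrite g0; exact: chart1_dom.
have df := smooth_at_differentiable (msmooth_chart sf (chart1_atlas H) cf).
have dg := smooth_at_differentiable (msmooth_chart sg (chart1_atlas H) cg).
have [dfg ed] := is_diff_pairE df dg.
have dm : differentiable mulc ((c1 \o f) 0, (c1 \o g) 0).
  by rewrite /= f0 g0; exact: smooth_at_differentiable smooth_mulc.
have := derive_comp (1 : R) dfg dm; rewrite ed /= f0 g0 derive_mulc => <-.
apply: near_eq_derive.
apply: filterS (filterI (chart_dom_near sf.1 cf) (chart_dom_near sg.1 cg)) =>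
  t [ft gt].
by rewrite /mulc /= !cfunK.
Qed.

Variable expo : L -> H.
Hypothesis hexp : is_exponential expo.

Lemma expo_add X (s t : R) : expo ((s + t) *: X) = lmul (expo (s *: X))
  (expo (t *: X)).
Proof. by case: hexp. Qed.

Lemma expo0 : expo 0 = one.
Proof.
apply: (@lmulI (expo 0)); rewrite lmulr1.
by have := expo_add 0 0 0; rewrite !scaler0 => <-.
Qed.

Lemma expoN (X : L) : linv (expo X) = expo (- X).
Proof.
apply: linv_eq; have := expo_add X 1 (-1).
by rewrite subrr scale0r expo0 scale1r scaleN1r.
Qed.

Lemma msmooth_expo_line (X : L) (t : R) : msmooth set0 (fun t : R => expo (t *: X))
  t.
Proof.
apply: (msmooth_comp (Q := set0) (f := fun t : R => t *: X)).
  have s1 := smooth_at_weaken setT (smooth_at_id set0 t).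
  exact: smooth_at_weaken (smooth_at_scale X s1).
by case: hexp => sexp _ _; exact: (msmooth_flat _ sexp).
Qed.

Lemma derive_expo (X : L) : 'D_1 (c1 \o (fun t : R => expo (t *: X))) 0 = X.
Proof. by case: hexp => _ _ /(_ X)[]. Qed.

Lemma expo_line_inj (X Y : L) : (forall t : R, expo (t *: X) = expo (t *: Y)) ->
  X = Y.
Proof.
move=> XY; rewrite -[LHS]derive_expo -[RHS]derive_expo.
by have -> : (fun t : R => expo (t *: X)) = (fun t => expo (t *: Y)) by apply/funext.
Qed.

Lemma translate_differentiable (g h : H) (d : chart H L) : atlas d ->
  cdom d (lmul g h) ->
  differentiable ((fun x => d (lmul (lmul g x) h)) \o cinv c1) e.
Proof.
move=> ad dgh.
have s1 : msmooth set0 (fun y : L => lmul (lmul g (cinv c1 y)) h) e.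
  apply: msmooth_mul; last exact: msmooth_cst.
  apply: msmooth_mul; first exact: msmooth_cst.
  apply: msmooth_weaken; apply: msmooth_cinv;
    [exact: chart1_atlas|exact: chart1_img].
apply: smooth_at_differentiable (msmooth_chart s1 ad _).
by rewrite cinv1 lmulr1.
Qed.

(* The curve [f t * expo (- t X)] has null velocity. *)
Lemma one_parameter_unique (f : R -> H) (X : L) :
  (forall t, msmooth set0 f t) -> (forall s t, f (s + t) = lmul (f s) (f t)) ->
  'D_1 (c1 \o f) 0 = X -> forall t, f t = expo (t *: X).
Proof.
move=> sf fD fX t.
have f0 : f 0 = one.
  by apply: (@lmulI (f 0)); rewrite lmulr1 -fD addr0.
pose del t := lmul (f t) (expo (t *: - X)).
have sdel s : msmooth set0 del s by apply: msmooth_mul => //;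
  exact: msmooth_expo_line.
have del0 : del 0 = one by rewrite /del f0 scale0r expo0 lmul1.
have cdel0 : cdom c1 (del 0) by rewrite del0; exact: chart1_dom.
have vdel : 'D_1 (c1 \o del) 0 = 0.
  have := derive_mul (sf 0) (msmooth_expo_line (- X) 0) f0.
  by rewrite scale0r expo0 fX derive_expo subrr => /(_ erefl).
suff : del t = one.
  move=> dt; apply: (@lmulI (linv (f t))); rewrite lmulV.
  have -> : linv (f t) = expo (t *: - X) by exact: linv_eq.
  by rewrite scalerN -expoN lmulV.
rewrite -del0; apply: constant_of_null_velocity => // s.
have [d ad ds] := atlas_cover (del s); exists d; split=> //.
have := (derive_translate (d \o del) s 0 (1 : R)).1; rewrite addr0 => <-.
(* Since [f] is a homomorphism, [del (s + h)] is [del h] multiplied by [f s] on the left and by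
   [expo (s *: - X)] on the right. The velocity at [s] is thus the image of the velocity at 0 under
   the differential of a two-sided translation. *)
pose phi x := d (lmul (lmul (f s) x) (expo (s *: - X))).
have -> : (fun h : R => (d \o del) (s + h)) = phi \o del.
  apply/funext => h; rewrite /phi /= /del addrC expo_add (addrC h) fD.
  by rewrite !lmulA.
rewrite (derive_through_chart _ (sdel 0).1 cdel0); first last.
- by rewrite /= del0; exact: translate_differentiable.
- exact: smooth_at_differentiable (msmooth_chart (sdel 0) (chart1_atlas H) cdel0).
by rewrite vdel derive0.
Qed.

Definition lconj (g x : H) := lmul (lmul g x) (linv g).

Lemma lconj1 g : lconj g one = one.
Proof. by rewrite /lconj lmulr1 lmulVr. Qed.

Lemma smooth_lconj g : smooth_at (@ci_graph R n) (@ci_graph R n)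
  (c1 \o (lconj g \o cinv c1)) e.
Proof.
apply: msmooth_chart; [|exact: chart1_atlas|].
  apply: msmooth_mul; last exact: msmooth_cst.
  apply: msmooth_mul; first exact: msmooth_cst.
  apply: msmooth_cinv; [exact: chart1_atlas|exact: chart1_img].
by rewrite /= cinv1 lconj1; exact: chart1_dom.
Qed.

Lemma derive_lconj g (f : R -> H) : msmooth set0 f 0 -> f 0 = one ->
  'D_1 (fun t => c1 (lconj g (f t))) 0 =
  'D_('D_1 (c1 \o f) 0) (c1 \o (lconj g \o cinv c1)) e.
Proof.
move=> sf f0.
have cf : cdom c1 (f 0) by rewrite f0; exact: chart1_dom.
have := @derive_through_chart R n H c1 _ (c1 \o lconj g) R f 0 (1 : R) sf.1 cf.
rewrite f0; apply.
  exact: smooth_at_differentiable (msmooth_chart sf (chart1_atlas H) cf).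
exact: smooth_at_differentiable (smooth_lconj g).
Qed.

Lemma AdE g Y : Ad expo g Y = 'D_Y (c1 \o (lconj g \o cinv c1)) e.
Proof.
rewrite /Ad derive1E.
rewrite (derive_lconj g (msmooth_expo_line Y 0)); last by rewrite scale0r expo0.
by rewrite derive_expo.
Qed.

Lemma Ad_mx g : exists A : 'M[R]_(n + n), forall Y, Ad expo g Y = Y *m A.
Proof.
exists (jacobian (c1 \o (lconj g \o cinv c1)) e) => Y.
by rewrite AdE deriveEjacobian //; exact: smooth_at_differentiable (smooth_lconj g).
Qed.

(** Conjugation by a fixed element is holomorphic; this is its Cauchy-Riemann equation at the
    unit. *)
Lemma Ad_muli g Y : Ad expo g (muli Y) = muli (Ad expo g Y).
Proof.
have [ O [oO Oe _ HJ]] := smooth_lconj g.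
by rewrite !AdE; apply: (HJ e Y (muli Y) Oe).
Qed.

Lemma expo_Ad g Y (t : R) : lconj g (expo (t *: Y)) = expo (t *: Ad expo g Y).
Proof.
apply: (one_parameter_unique (f := fun t => lconj g (expo (t *: Y)))) => [s|s r|].
- apply: msmooth_mul; last exact: msmooth_cst.
  by apply: msmooth_mul; [exact: msmooth_cst|exact: msmooth_expo_line].
- rewrite /lconj expo_add !lmulA; congr lmul; congr lmul.
  by rewrite -(lmulA _ (linv g)) lmulV lmulr1.
- by rewrite /Ad derive1E.
Qed.

Lemma Ad_mul g h Y : Ad expo (lmul g h) Y = Ad expo g (Ad expo h Y).
Proof.
apply: expo_line_inj => t.
apply: (etrans (esym (expo_Ad (lmul g h) Y t))).
apply: (etrans _ (expo_Ad g (Ad expo h Y) t)).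
rewrite -(expo_Ad h Y t) /lconj.
have -> : linv (lmul g h) = lmul (linv h) (linv g).
  by apply: linv_eq; rewrite lmulA -(lmulA g h) lmulVr lmulr1 lmulVr.
by rewrite !lmulA.
Qed.

Lemma Ad_one Y : Ad expo one Y = Y.
Proof.
apply: expo_line_inj => t; rewrite -expo_Ad /lconj lmul1.
by rewrite (_ : linv one = one) ?lmulr1//; apply: linv_eq; rewrite lmul1.
Qed.

End LieGroup.

Section Subspace.
Context {R : realType}.

(** Membership written as a linear equation passes through derivatives and integrals. *)
Lemma vspace_mx n (W : {vspace 'rV[R]_n}) :
  exists P : 'M[R]_n, forall v, (v \in W) = (v *m P == v).
Proof.
exists (lin1_mx (projv W)) => v; rewrite mul_rV_lin1; apply/idP/eqP => [vW|<-].
  exact: projv_id.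
exact: memv_proj.
Qed.

Lemma derive_in_vspace n (W : {vspace 'rV[R]_n}) (f : R -> 'rV[R]_n) t :
  (forall t, f t \in W) -> derivable f t 1 -> 'D_1 f t \in W.
Proof.
have [P PW] := vspace_mx W => fW /derivable1_diffP df; rewrite PW -derive_mulmx //.
by have -> : (fun y => f y *m P) = f by apply/funext => s; apply/eqP; rewrite -PW.
Qed.

End Subspace.

(** * The bracket and commuting exponentials *)

Section Bracket.
Context {R : realType} {n : nat} (H : complex_lie_group R n).
Local Notation L := 'rV[R]_(n + n).
Local Notation c1 := (@chart1 R n H).
Local Notation one := (@lone R n H).
Local Notation e := (c1 one).
Local Notation mH := (mulc H).
Variable expo : L -> H.
Hypothesis hexp : is_exponential expo.

Definition conjc (p : L * L) : L := c1 (lconj (cinv c1 p.1) (cinv c1 p.2)).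

Lemma smooth_conjc : smooth_at set0 setT conjc (e, e).
Proof.
have s1 := @msmooth_cinv_fst R n H; have s2 := @msmooth_cinv_snd R n H.
have s := msmooth_mul (msmooth_mul s1 s2) (msmooth_inv s1).
have := msmooth_chart s (chart1_atlas H).
rewrite /= cinv1 lmul1 lmulVr => /(_ (chart1_dom H)); exact: smooth_at_weaken.
Qed.

Lemma Ad_conjc x Y : Ad expo (cinv c1 x) Y = 'D_(0, Y) conjc (x, e).
Proof. by rewrite (AdE hexp) -derive_snd. Qed.

Lemma conjc1 x : conjc (x, e) = e.
Proof. by rewrite /conjc /= cinv1 lconj1. Qed.

Let xt (X : L) (t : R) : L := c1 (expo (t *: X)).

Lemma xt_props X : [/\ xt X 0 = e, differentiable (xt X) 0, 'D_1 (xt X) 0 = X &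
  \forall t \near (0 : R), cinv c1 (xt X t) = expo (t *: X)].
Proof.
have x0 : expo ((0 : R) *: X) = one by rewrite scale0r (expo0 hexp).
have c0 : cdom c1 (expo ((0 : R) *: X)) by rewrite x0; exact: chart1_dom.
have s := msmooth_expo_line hexp X 0; split.
- by rewrite /xt x0.
- exact: (smooth_at_differentiable (msmooth_chart s (chart1_atlas H) c0)).
- exact: derive_expo.
- by apply: filterS (chart_dom_near s.1 c0) => t ct; rewrite cfunK.
Qed.

(* Differentiate [(x y x^-1) x = x y] in [y] at the unit. *)
Lemma derive_mulc_Ad Y : \forall x \near e,
  'D_(Ad expo (cinv c1 x) Y, 0) mH (e, x) = 'D_(0, Y) mH (x, e).
Proof.
have nm : \forall x \near e, differentiable mH (e, x).
  have c : {for e, continuous (fun x : L => (e, x))}.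
    by apply: continuous_pair; [exact: continuous_const|exact: continuous_self].
  apply: (c [set p | differentiable mH p]).
  by apply: filterS (smooth_at_near (@smooth_mulc R n H)) => p;
    exact: smooth_at_differentiable.
have nc : \forall x \near e, differentiable conjc (x, e).
  have c : {for e, continuous (fun x : L => (x, e))}.
    by apply: continuous_pair; [exact: continuous_self|exact: continuous_const].
  apply: (c [set p | differentiable conjc p]).
  by apply: filterS (smooth_at_near smooth_conjc) => p;
    exact: smooth_at_differentiable.
apply: filterS (filterI nm (filterI nc (near_cdom1 H))) => x [dm [dc [cx ex]]].
have dy : differentiable (fun y : L => (x, y)) e.
  have [d _] := is_diff_pairE (differentiable_cst x e) (differentiable_self e).
  exact: d.
have dc' : differentiable (fun y : L => conjc (x, y)) e := differentiable_comp dy dc.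
have [dp ep] := is_diff_pairE dc' (differentiable_cst x e).
have dm' : differentiable mH (conjc (x, e), x) by rewrite conjc1.
rewrite Ad_conjc -[in LHS]derive_snd.
have E1 := derive_comp Y dp dm'; rewrite ep derive_cst conjc1 in E1.
rewrite -{}E1 -derive_snd; apply: near_eq_derive.
have sc : msmooth set0 (fun y : L => lconj (cinv c1 x) (cinv c1 y)) e.
  apply: msmooth_mul; last exact: msmooth_cst.
  apply: msmooth_mul; first exact: msmooth_cst.
  by apply: msmooth_weaken; apply: msmooth_cinv;
    [exact: chart1_atlas|exact: chart1_img].
have c0 : cdom c1 (lconj (cinv c1 x) (cinv c1 e)).
  by rewrite cinv1 lconj1; exact: chart1_dom.
apply: filterS (chart_dom_near sc.1 c0) => y cy.
rewrite /mulc /conjc /= (cfunK cy) /lconj -lmulA lmulV lmulr1 //.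
Qed.

Lemma derivable_Ad X Y : derivable (fun t : R => Ad expo (expo (t *: X)) Y) 0 1.
Proof.
have [x0 dx _ nx] := xt_props X.
apply: diff_derivable.
have d1 : differentiable (fun t : R => (xt X t, e)) 0 :=
  (is_diff_pairE dx (differentiable_cst e 0)).1.
have d2 : differentiable ('D_(0, Y) conjc) (xt X 0, e).
  by rewrite x0; exact: smooth_at_differentiable (smooth_at_derive _ smooth_conjc).
apply: differentiable_near_eq (differentiable_comp d1 d2).
by apply: filterS nx => t et /=; rewrite -Ad_conjc et.
Qed.

(** The identity of [derive_mulc_Ad] is differentiated along [x = expo (t *: X)]. With
    [Ad Y = Y + b t], its left side splits into [Q Y t] and the derivative [S t] in the direction
    [(b t, 0)]. As [b 0 = 0] and ['D_(v, 0) mH (e, e) = v], the derivative of [S] at 0 is the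
    bracket. *)
Lemma bracketE X Y : bracket expo X Y =
  'D_(X, 0) ('D_(0, Y) mH) (e, e) - 'D_(0, X) ('D_(Y, 0) mH) (e, e).
Proof.
have sm := @smooth_mulc R n H.
have [x0 dx Dx nx] := xt_props X.
have cx : {for 0, continuous (xt X)} := differentiable_continuous dx.
have [d1 e1] := is_diff_pairE dx (differentiable_cst e (0 : R)).
have [d2 e2] := is_diff_pairE (differentiable_cst e (0 : R)) dx.
pose P t := 'D_(0, Y) mH (xt X t, e).
pose Q v t := 'D_(v, 0) mH (e, xt X t).
have DP : 'D_1 P 0 = 'D_(X, 0) ('D_(0, Y) mH) (e, e).
  have dd : differentiable ('D_(0, Y) mH) (xt X 0, e).
    by rewrite x0; exact: smooth_at_differentiable (smooth_at_derive _ sm).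
  have := derive_comp (1 : R) d1 dd; rewrite e1 Dx derive_cst x0; exact.
have dQ v : differentiable (Q v) 0 /\ 'D_1 (Q v) 0 = 'D_(0, X) ('D_(v, 0) mH) (e, e).
  have dd : differentiable ('D_(v, 0) mH) (e, xt X 0).
    by rewrite x0; exact: smooth_at_differentiable (smooth_at_derive _ sm).
  split; first exact: differentiable_comp d2 dd.
  have := derive_comp (1 : R) d2 dd; rewrite e2 Dx derive_cst x0; exact.
pose b t := Ad expo (expo (t *: X)) Y - Y.
have db : derivable b 0 1 by apply: derivableB;
  [exact: derivable_Ad|exact: derivable_cst].
have Db : 'D_1 b 0 = bracket expo X Y.
  have := deriveB (@derivable_Ad X Y) (derivable_cst Y (0 : R) 1).
  by rewrite derive_cst subr0 /bracket derive1E; exact.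
have b0 : b 0 = 0 by rewrite /b scale0r (expo0 hexp) (Ad_one hexp) subrr.
(* Expanding [b t] in the basis leaves derivatives in fixed directions, with scalar coefficients
   that vanish at 0. *)
pose S t := \sum_j b t 0 j *: Q 'e_j t.
have dS : is_derive (0 : R) 1 S (bracket expo X Y).
  have dj j : is_derive (0 : R) 1 (fun t => b t 0 j *: Q 'e_j t)
    ((bracket expo X Y) 0 j *: 'e_j).
    have dbj := (derivable_mxP b 0 1).1 db 0 j.
    have Q0 : Q 'e_j 0 = 'e_j by rewrite /Q x0 derive_mulc addr0.
    have bj0 : b 0 0 j = 0 by rewrite b0 mxE.
    have Dbj : (bracket expo X Y) 0 j = 'D_1 (fun t => b t 0 j) 0.
      by rewrite -Db (derive_row j db).
    have cQ : {for 0, continuous (Q 'e_j)} := differentiable_continuous (dQ 'e_j).1.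
    by have := is_derive_scale_at0 dbj bj0 cQ; rewrite Q0 -Dbj.
  have ES : \sum_j (fun t => b t 0 j *: Q 'e_j t) = S by apply/funext => t;
    rewrite fct_sumE.
  have := is_derive_sum dj; rewrite ES -row_sum_delta; exact.
have PQ : \forall t \near (0 : R), P t = Q Y t + S t.
  have nm : \forall t \near (0 : R), differentiable mH (e, xt X t).
    have c : {for (0 : R), continuous (fun t => (e, xt X t))}.
      by apply: continuous_pair; [exact: continuous_const|exact: cx].
    apply: (c [set p | differentiable mH p]); rewrite x0.
    by apply: filterS (smooth_at_near sm) => p; exact: smooth_at_differentiable.
  have cx0 : xt X t @[t --> (0 : R)] --> e by rewrite -x0; exact: cx.
  have nAt : \forall t \near (0 : R),
    'D_(Ad expo (cinv c1 (xt X t)) Y, 0) mH (e, xt X t) =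
      'D_(0, Y) mH (xt X t, e) := cx0 _ (derive_mulc_Ad Y).
  apply: filterS (filterI nAt (filterI nm nx)) => t [At [dm et]].
  rewrite /P -At et /Q /S.
  have -> : Ad expo (expo (t *: X)) Y = Y + b t by rewrite addrC subrK.
  have add v w : 'D_(v + w, 0) mH (e, xt X t) =
      'D_(v, 0) mH (e, xt X t) + 'D_(w, 0) mH (e, xt X t).
    have -> : (v + w, 0) = (v, 0) + (w, 0) :> L * L by congr (_, _);
      rewrite /= addr0.
    exact: (derive_add _ _ dm).
  rewrite add; congr (_ + _).
  have dm' : differentiable (fun x => mH (x, xt X t)) e.
    have [d _] :=
      is_diff_pairE (differentiable_self e) (differentiable_cst (xt X t) e).
    exact: differentiable_comp d dm.
  rewrite -derive_fst (derive_row_sum _ dm').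
  by apply: eq_bigr => j _; rewrite derive_fst.
have [dS1 dS2] := dS.
have [dQ1 dQ2] := dQ Y.
have DPS : 'D_1 P 0 = 'D_1 (fun t => Q Y t + S t) 0 := near_eq_derive _ PQ.
have DS : 'D_1 (fun t => Q Y t + S t) 0 = 'D_1 (Q Y) 0 + 'D_1 S 0 :=
  deriveD (diff_derivable dQ1) dS1.
have alg (u v w : L) : u = v + w -> w = u - v by move=> ->; rewrite addrC addKr.
exact: (alg _ _ _ (etrans (esym DP) (etrans DPS (etrans DS (congr2 +%R dQ2 dS2))))).
Qed.

(** Interchanging the order of differentiation in each term of [bracketE] exchanges the roles of [X]
    and [Y] and the two terms. *)
Lemma bracket_antisym X Y : bracket expo X Y = - bracket expo Y X.
Proof.
have [ O [oO Oe Cm _]] := @smooth_mulc R n H.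
rewrite (bracketE X Y) (bracketE Y X) opprB.
have s1 := schwarz_row (X, 0) (0, Y) oO Oe (Cm 2).
have s2 := schwarz_row (0, X) (Y, 0) oO Oe (Cm 2).
exact: (congr2 (fun a b => a - b) s1 s2).
Qed.

Lemma bracket_muli X Y : bracket expo X (muli Y) = muli (bracket expo X Y).
Proof.
rewrite /bracket !derive1E.
have -> : (fun t : R => Ad expo (expo (t *: X)) (muli Y)) =
    (fun t => Ad expo (expo (t *: X)) Y *m imx R n).
  by apply/funext => t; rewrite (Ad_muli hexp).
by apply: derive_mulmx; apply/derivable1_diffP; exact: derivable_Ad.
Qed.

Lemma muliK (X : L) : muli (muli X) = - X.
Proof.
have J2 : imx R n *m imx R n = - 1%:M.
  rewrite /imx mulmx_block !mulmx0 !mul0mx mul1mx mulNmx mul1mx !addr0 add0r.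
  by rewrite (scalar_mx_block n n) opp_block_mx !oppr0.
by rewrite /muli -mulmxA J2 mulmxN mulmx1.
Qed.

(** The derivative of [Ad (exp tX) Y] at [s] is [Ad (exp sX) [X, Y] = 0], so [Y] is fixed and the
    two one-parameter subgroups commute. Their product is then a one-parameter subgroup with
    velocity [X + Y], and uniqueness identifies it. *)
Lemma commute_of_bracket X Y : bracket expo X Y = 0 ->
  expo (X + Y) = lmul (expo X) (expo Y).
Proof.
move=> XY.
have AdY (t : R) : Ad expo (expo (t *: X)) Y = Y.
  have d (s : R) : is_derive s 1 (fun t : R => Ad expo (expo (t *: X)) Y) 0.
    have [A EA] := Ad_mx hexp (expo (s *: X)).
    have e' : (fun h : R => Ad expo (expo ((s + h) *: X)) Y) =
        (fun h => Ad expo (expo (h *: X)) Y *m A).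
      by apply/funext => h; rewrite (expo_add hexp) (Ad_mul hexp) EA.
    have dA : differentiable (fun h : R => Ad expo (expo (h *: X)) Y) 0.
      by apply/derivable1_diffP; exact: derivable_Ad.
    have d0 : derivable (fun h : R => Ad expo (expo ((s + h) *: X)) Y) 0 1.
      rewrite e'; apply: diff_derivable.
      exact:
        (differentiable_comp dA
          (linear_differentiable (f := mulmxr A) _ (@continuous_mulmxr _ _ _ A))).
    have D0 : 'D_1 (fun h : R => Ad expo (expo ((s + h) *: X)) Y) 0 = 0.
      rewrite e' derive_mulmx //.
      by move: XY; rewrite /bracket derive1E => ->; rewrite mul0mx.
    have e2 : (fun t : R => Ad expo (expo (t *: X)) Y) =
        (fun t => (fun h : R => Ad expo (expo ((s + h) *: X)) Y) (- s + t)).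
      by apply/funext => z; rewrite addNKr.
    have [t1 t2] := derive_translate (fun h : R => Ad expo (expo ((s + h) *: X)) Y)
      (- s) s (1 : R).
    rewrite addNr in t1 t2.
    by rewrite e2; apply: DeriveDef; [exact: t2|rewrite t1].
  have c (r : R) : Ad expo (expo (r *: X)) Y = Ad expo (expo ((0 : R) *: X)) Y.
    apply/rowP => j.
    apply: (@derive_line_eq0 _ (fun r => Ad expo (expo (r *: X)) Y 0 j)) => s _.
    have [d1 e1] := d s.
    apply: DeriveDef; first exact: ((derivable_mxP _ _ _).1 d1 0 j).
    by rewrite -(derive_row j d1) e1 mxE.
  by rewrite c scale0r (expo0 hexp) (Ad_one hexp).
have comm (s t : R) : lmul (expo (s *: X)) (expo (t *: Y)) = lmul (expo (t *: Y))
  (expo (s *: X)).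
  have := expo_Ad hexp (expo (s *: X)) Y t; rewrite AdY /lconj => E.
  by rewrite -[in RHS]E -!lmulA lmulV lmulr1.
pose f (t : R) := lmul (expo (t *: X)) (expo (t *: Y)).
have sf t : msmooth set0 f t by apply: msmooth_mul; exact: msmooth_expo_line.
have fD s t : f (s + t) = lmul (f s) (f t).
  rewrite /f !(expo_add hexp) !lmulA; congr lmul.
  by rewrite -!lmulA comm.
have fv : 'D_1 (c1 \o f) 0 = X + Y.
  have := derive_mul (msmooth_expo_line hexp X 0) (msmooth_expo_line hexp Y 0).
  rewrite !scale0r !(expo0 hexp) !(derive_expo hexp) => /(_ erefl erefl); exact.
by have := one_parameter_unique hexp sf fD fv 1; rewrite /f !scale1r => <-.
Qed.

Lemma Ad_lie_of (S : set H) g Y : is_subgroup S -> S g -> lie_of expo S Y ->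
  lie_of expo S (Ad expo g Y).
Proof.
move=> [_ SM SV] Sg SY t; rewrite -(expo_Ad hexp).
by apply: (SM); [apply: (SM) => //; exact: SY|exact: SV].
Qed.

(** The curve [Ad (exp tX) Y] stays in the subspace [h], hence so does its derivative. *)
Lemma bracket_lie_algebra (S : set H) (h : {vspace L}) X Y : is_subgroup S ->
  is_lie_algebra expo S h -> X \in h -> Y \in h -> bracket expo X Y \in h.
Proof.
move=> gS hS; have inh Z : (Z \in h) = lie_of expo S Z :> Prop.
  by move: hS => /(congr1 (fun A => A Z)).
rewrite /bracket derive1E => Xh Yh; apply: derive_in_vspace;
  last exact: derivable_Ad.
move=> t; rewrite inh; apply: Ad_lie_of => //; last by rewrite -inh.
by move: Xh; rewrite inh => /(_ t).
Qed.

Lemma mem_ivs (u : {vspace L}) X : X \in ivs u -> exists2 X', X' \in u & X = muli X'.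
Proof. by move=> /memv_imgP[X' uX' ->]; exists X' => //; rewrite lfunE. Qed.

(* For [X = i X'] and [Y = i Y'], [[X, Y] = - [X', Y']] lies in [u]. *)
Lemma bracket_ivs_eq0 (U : set H) (u a : {vspace L}) X Y : is_subgroup U ->
  is_lie_algebra expo U u -> (u :&: ivs u)%VS = 0%VS -> (a <= ivs u)%VS ->
  (forall X Y, X \in a -> Y \in a -> bracket expo X Y \in a) ->
  X \in a -> Y \in a -> bracket expo X Y = 0.
Proof.
move=> gU hU uiu au ha Xa Ya.
have bi : bracket expo X Y \in ivs u by apply: (subvP au); exact: ha.
have [X' uX eX] := mem_ivs (subvP au _ Xa);
  have [Y' uY eY] := mem_ivs (subvP au _ Ya).
have bu : bracket expo X Y \in u.
  rewrite eX eY bracket_muli bracket_antisym bracket_muli bracket_antisym.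
  have -> : muli (- muli (- bracket expo X' Y')) = - bracket expo X' Y'.
    by rewrite /muli !mulNmx opprK; exact: muliK.
  by rewrite rpredN; exact: bracket_lie_algebra hU uX uY.
by apply/eqP; rewrite -memv0 -uiu memv_cap bu.
Qed.

End Bracket.

(** * Integrals depending on a parameter *)

Section Borel.
Context {R : realType} {T : ptopologicalType}.
Variable nu : probability (borel T) R.
Variable M : set T.
Hypothesis cM : compact M.
Hypothesis hT : hausdorff_space T.

Lemma open_borel (A : set T) : open A -> measurable (A : set (borel T)).
Proof. by move=> oA; apply: sub_sigma_algebra. Qed.

Lemma closed_borel (A : set T) : closed A -> measurable (A : set (borel T)).
Proof. by move=> cA; rewrite -(setCK A); apply: measurableC; apply: open_borel;
  exact: closed_openC. Qed.

Lemma compact_borel : measurable (M : set (borel T)).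
Proof. by apply: closed_borel; exact: compact_closed. Qed.

Lemma continuous_borel (f : T -> T) : continuous f ->
  measurable_fun setT (f : borel T -> borel T).
Proof.
move=> cf; apply: (measurability (@open T : set (set (borel T)))) => //.
move=> _ [A oA <-]; rewrite setTI; apply: open_borel; apply: open_comp => // x _;
  exact: cf.
Qed.

Lemma continuous_borel_real (g : T -> R) : continuous g ->
  measurable_fun setT (g : borel T -> R).
Proof.
move=> cg; apply: (measurability _ (RGenOpens.measurableE R)).
move=> _ [_ [a [b ->]] <-]; rewrite setTI; apply: open_borel;
  apply: open_comp => [x _|]; first exact: cg.
exact: interval_open.
Qed.

Lemma continuous_bounded (g : T -> R) : compact [set: T] -> continuous g ->
  exists C, forall x, `|g x| <= C.
Proof.
move=> cT cg.
have [C [_ HC]] : bounded_set (g @` setT).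
  by apply: compact_bounded; apply: continuous_compact => //;
    exact: continuous_subspaceT.
exists (C + 1) => x; apply: HC; last by exists x.
by rewrite ltrDl.
Qed.

Lemma continuous_integrable (g : T -> R) : compact [set: T] -> continuous g ->
  nu.-integrable M (EFin \o (g : borel T -> R)).
Proof.
move=> cT cg; apply: measurable_bounded_integrable.
- exact: compact_borel.
- by rewrite (le_lt_trans (probability_le1 _ compact_borel))// ltry.
- by apply: measurable_funTS; exact: continuous_borel_real.
- have [C HC] := continuous_bounded cT cg.
  exists C; split; first exact: num_real.
  by move=> D CD x _ /=; rewrite (le_trans (HC x))// ltW.
Qed.

End Borel.

(** * Differentiation under the integral sign *)

Section ParameterIntegral.
Context {R : realType} {m N : nat} (Z : complex_manifold R m).
Local Notation V := 'rV[R]_N.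
Local Notation W := 'rV[R]_(m + m).
Variable nu : probability (borel Z) R.
Variable M : set Z.
Hypothesis cM : compact M.
Hypothesis cZ : compact [set: Z].
Variable O : set V.
Hypothesis oO : open O.

(* Joint smoothness in the parameter and in local coordinates of [Z]. *)
Definition jsmooth (th : V -> Z -> R) := forall y z, O y ->
  exists c : chart Z W, [/\ atlas c, cdom c z &
    smooth_at set0 setT (fun q : V * W => th q.1 (cinv c q.2)) (y, c z)].

(** A derivative in the parameter is the derivative of the joint map in the direction [(v, 0)], so
    joint smoothness survives; this drives the induction in [pint_Ck]. *)
Lemma jsmooth_derive th v : jsmooth th -> jsmooth (fun y z => 'D_v (th ^~ z) y).
Proof.
move=> sth y z Oy; have [c [ac cz sc]] := sth y z Oy; exists c; split=> //.
have := smooth_at_derive (v, 0) sc; congr smooth_at.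
by apply/funext => -[a b]; rewrite -derive_fst.
Qed.

Lemma jsmooth_continuous th y z : jsmooth th -> O y ->
  {for (y, z), continuous (fun q => th q.1 q.2)}.
Proof.
move=> sth Oy; have [c [ac cz sc]] := sth y z Oy.
have cc : {for (y, z), continuous (fun q : V * Z => (q.1, c q.2))}.
  apply: continuous_pair; first exact: cvg_fst.
  by apply: (cvg_comp _ _ cvg_snd); exact: cfun_continuous.
have := continuous_comp cc (smooth_at_continuous sc).
have e : \forall q \near (y, z), th q.1 (cinv c (c q.2)) = th q.1 q.2.
  have : \forall q \near (y, z), cdom c q.2.
    by apply: (chart_dom_near (f := fun q : V * Z => q.2)); [exact: cvg_snd|].
  by apply: filterS => q cq; rewrite cfunK.
rewrite /prop_for /continuous_at /= cfunK// => h.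
by apply: cvg_trans h; apply: near_eq_cvg.
Qed.

Lemma jsmooth_differentiable th y z : jsmooth th -> O y ->
  differentiable (th ^~ z) y.
Proof.
move=> sth Oy; have [c [ac cz sc]] := sth y z Oy.
have d := (is_diff_pairE (differentiable_self y) (differentiable_cst (c z) y)).1.
have := differentiable_comp d (smooth_at_differentiable sc).
rewrite (_ : _ \o _ = th ^~ z)//.
by apply/funext => x; rewrite /= cfunK.
Qed.

Lemma jsmooth_continuous2 th y : jsmooth th -> O y -> continuous (th y).
Proof.
move=> sth Oy z.
have cc : {for z, continuous (fun z : Z => (y, z))}.
  by apply: continuous_pair; [exact: continuous_const|exact: continuous_self].
exact:
  (@continuous_comp _ _ _ (fun z : Z => (y, z)) (fun q : V * Z => th q.1 q.2) z cc
    (jsmooth_continuous sth Oy)).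
Qed.

(** Joint continuity gives the estimate near each point [z], and the compactness of [Z] makes the
    neighbourhood of [y0] common to all of them. *)
Lemma jsmooth_uniform th y0 (d : R) : jsmooth th -> O y0 -> 0 < d ->
  \forall y \near y0, forall z, `|th y z - th y0 z| <= d.
Proof.
move=> sth Oy d0.
have nc := proj1 (compact_near_coveringP setT) cZ V (nbhs y0)
  (fun y z => `|th y z - th y0 z| <= d) (nbhs_filter _).
have H : forall z : Z, setT z -> \forall z' \near z & y \near y0,
  `|th y z' - th y0 z'| <= d.
  move=> z _.
  have c1 : {for (z, y0), continuous (fun q : Z * V => th q.2 q.1)}.
    have cs : {for (z, y0), continuous (fun q : Z * V => (q.2, q.1))}.
      by apply: continuous_pair; [exact: cvg_snd|exact: cvg_fst].
    exact:
      (@continuous_comp _ _ _ (fun q : Z * V => (q.2, q.1))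
        (fun q : V * Z => th q.1 q.2) (z, y0) cs (jsmooth_continuous sth Oy)).
  have c2 : {for (z, y0), continuous (fun q : Z * V => th y0 q.1)}.
    by apply: (cvg_comp _ _ cvg_fst); exact: jsmooth_continuous2.
  have c3 : {for (z, y0), continuous (fun q : Z * V => `|th q.2 q.1 - th y0 q.1|)}.
    by apply: cvg_norm; exact: (continuous_sub c1 c2).
  have : \forall q \near (z, y0), `|th q.2 q.1 - th y0 q.1| < d.
    apply: (c3 [set t | t < d]); apply: open_nbhs_nbhs; split; first exact: open_lt.
    by rewrite /= subrr normr0.
  by apply: filterS => q /ltW.
by apply: filterS (nc H) => y Hy z; exact: (Hy z).
Qed.

Definition pint (th : V -> Z -> R) (y : V) : R := \int[nu]_(z in M) th y z.

Lemma borelM : measurable (M : set (borel Z)).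
Proof. exact: compact_borel cM (@cm_hausdorff _ _ Z). Qed.

Lemma integrableM (g : Z -> R) : continuous g ->
  nu.-integrable M (EFin \o (g : borel Z -> R)).
Proof. exact: (continuous_integrable nu cM (@cm_hausdorff _ _ Z) cZ). Qed.

Lemma norm_Rintegral_le (g : Z -> R) C : 0 <= C -> continuous g ->
  (forall z, `|g z| <= C) ->
  `|\int[nu]_(z in M) g z| <= C.
Proof.
move=> C0 cg gC.
have ng : nu.-integrable M (EFin \o (fun z : borel Z => `|g z|)).
  by apply: integrableM => z; apply: cvg_norm; exact: cg.
rewrite (le_trans (le_normr_Rintegral borelM (integrableM cg)))//.
have := le_Rintegral borelM ng (integrableM (@continuous_const _ _ C))
  (fun x _ => gC x).
move=> h; rewrite (le_trans h)// Rintegral_cst; last exact: borelM.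
rewrite ler_piMr// -lee_fin fineK ?probability_le1//; [exact: borelM|].
by apply: fin_num_measure; exact: borelM.
Qed.

Lemma Rintegral_lincomb (h : 'I_N -> R) (G : 'I_N -> Z -> R) :
  (forall j, continuous (G j)) ->
  continuous (fun z => \sum_j h j * G j z) /\
  \int[nu]_(z in M) (\sum_j h j * G j z) = \sum_j h j * \int[nu]_(z in M) G j z.
Proof.
move=> cG; elim: (index_enum _) => [|j r [IHc IHe]].
  split; first by move=> z; under eq_fun do rewrite big_nil; exact: continuous_const.
  by under eq_fun do rewrite big_nil; rewrite big_nil (Rintegral_cst _ borelM) mul0r.
have cj : continuous (fun z => h j * G j z).
  by move=> z; apply: cvgM; [exact: continuous_const|exact: cG].
split.
  move=> z; under eq_fun do rewrite big_cons.
  exact: (continuous_add (cj z) (IHc z)).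
under eq_fun do rewrite big_cons.
rewrite (RintegralD borelM (integrableM cj) (integrableM IHc)) IHe big_cons.
by rewrite (RintegralZl _ borelM (integrableM (cG j))).
Qed.

Lemma jsmooth_derive_sum th y z v : jsmooth th -> O y ->
  'D_v (th ^~ z) y = \sum_j v 0 j * 'D_('e_j) (th ^~ z) y.
Proof. by move=> sth Oy;
  exact: derive_row_sum (jsmooth_differentiable z sth Oy). Qed.

(** The candidate for the differential integrates the partial derivatives. The mean value theorem
    and the uniform continuity of these derivatives bound the pointwise remainder by [eps |h|] for
    all [z] at once, and [nu] has total mass 1. *)
Lemma pint_derivable th y : jsmooth th -> O y -> differentiable (pint th) y /\
  forall v, 'D_v (pint th) y = pint (fun y z => 'D_v (th ^~ z) y) y.
Proof.
move=> sth Oy.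
pose G j z := 'D_('e_j) (th ^~ z) y.
have cG j : continuous (G j) := jsmooth_continuous2 (jsmooth_derive 'e_j sth) Oy.
pose C : 'cV[R]_N := \col_j \int[nu]_(z in M) G j z.
pose l0 (h : V) := (h *m C) 0 0.
have ll : linear l0 by move=> a u v; rewrite /l0 mulmxDl -scalemxAl !mxE.
pose l : {linear V -> R} := HB.pack l0 (GRing.isLinear.Build _ _ _ _ _ ll).
have lE h : l h = \sum_j h 0 j * \int[nu]_(z in M) G j z.
  by rewrite /l /= /l0 mxE; apply: eq_bigr => j _; rewrite mxE.
have cl : continuous l.
  move=> h;
    exact:
      (continuous_comp (@continuous_mulmxr _ _ _ C h)
        (@coord_continuous _ _ _ 0 0 _)).
suff dl : is_diff y (pint th) l.
  split; first by have [] := dl.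
  move=> v; rewrite (is_diff_derive v dl) lE -(Rintegral_lincomb _ cG).2.
  by apply: eq_Rintegral => z _; rewrite jsmooth_derive_sum.
apply: differentiable_epsP => // eps e0.
(* The [N] coordinates of [h] contribute at most [|h| e1] each; the successor keeps the denominator
   nonzero for [N = 0]. *)
pose e1 := eps / N.+1%:R.
have e10 : 0 < e1 by rewrite divr_gt0.
have nU : \forall x \near y, O x /\ forall j z,
  `|'D_('e_j) (th ^~ z) x - G j z| <= e1.
  apply: filterI; first exact: open_nbhs_nbhs.
  have H j := jsmooth_uniform (jsmooth_derive 'e_j sth) Oy e10.
  exact:
    (filter_forall
      (f := fun j x => forall z, `|'D_('e_j) (th ^~ z) x - G j z| <= e1) _ H).
have [r /= r0 Hr] := (nbhs_normP _ _).1 nU.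
apply/nbhs_normP; exists r => // h; rewrite /ball_ /= sub0r normrN => hr.
have inr (t : R) : 0 <= t <= 1 -> `|y - (t *: h + y)| < r.
  move=> /andP[t0 t1]; rewrite opprD addrCA subrr addr0 normrN normrZ ger0_norm//.
  by rewrite (le_lt_trans _ hr)// ler_piMl.
have Oh : O (h + y) by have [] := Hr _ (inr 1 _); rewrite ?scale1r// lexx ler01.
have est z : `|th (h + y) z - th y z - \sum_j h 0 j * G j z| <= eps * `|h|.
  have dt (t : R) : 0 <= t <= 1 -> derivable (th ^~ z) (t *: h + y) h.
    move=> /inr /Hr[ Ot _]; apply: diff_derivable; exact: jsmooth_differentiable.
  have [t /andP[t0 t1]] := MVT_line ltr01 dt.
  have t01 : 0 <= t <= 1 by rewrite !ltW.
  have [Ot Ht] := Hr _ (inr t t01).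
  rewrite scale1r mul1r => ->; rewrite jsmooth_derive_sum// -sumrB.
  rewrite (le_trans (ler_norm_sum _ _ _))//.
  apply: (@le_trans _ _ (\sum_(j < N) `|h| * e1)).
    apply: ler_sum => j _; rewrite -mulrBr normrM; apply: ler_pM => //.
    by rewrite [leRHS]/Num.Def.normr/= mx_normrE; exact: (le_bigmax _ _ (0, j)).
  rewrite sumr_const card_ord -[_ *+ N]mulr_natr -mulrA mulrC ler_wpM2r//.
  rewrite /e1 mulrAC ler_pdivrMr// ler_pM2l// ler_nat//.
have cy := jsmooth_continuous2 sth Oy; have ch := jsmooth_continuous2 sth Oh.
have [cS eS] := Rintegral_lincomb (fun j => h 0 j) cG.
change (`|pint th (h + y) - pint th y - l h| <= eps * `|h|).
rewrite lE -eS /pint -(RintegralB borelM (integrableM ch) (integrableM cy)).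
have chy : continuous (fun z => th (h + y) z - th y z).
  by move=> z; exact: (continuous_sub (ch z) (cy z)).
rewrite -(RintegralB borelM (integrableM chy) (integrableM cS)).
apply: norm_Rintegral_le => //; first by rewrite mulr_ge0// ltW.
by move=> z; exact: (continuous_sub (chy z) (cS z)).
Qed.

Lemma pint_Ck k th : jsmooth th -> Ck_on k O (pint th).
Proof.
elim: k th => [|k IH] th sth.
  by move=> y Oy; apply: differentiable_continuous; exact: (pint_derivable sth Oy).1.
split=> [y Oy|v]; first exact: (pint_derivable sth Oy).1.
apply: (Ck_on_ext oO _ (IH _ (jsmooth_derive v sth))) => y Oy.
by rewrite (pint_derivable sth Oy).2.
Qed.

End ParameterIntegral.

(** * The gradient map along an orbit *)

Section OrthProj.
Context {R : realType} {n : nat}.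
Implicit Types (Q : 'M[R]_n) (W : {vspace 'rV[R]_n}).

Definition basis_mx W : 'M[R]_(\dim W, n) := \matrix_(j < \dim W) (vbasis W)`_j.

Lemma mem_basis_mx W (t : 'rV[R]_(\dim W)) : t *m basis_mx W \in W.
Proof.
rewrite mulmx_sum_row; apply: rpred_sum => j _; apply: rpredZ.
rewrite rowK; apply: vbasis_mem; apply: mem_nth; by rewrite size_tuple.
Qed.

Lemma basis_mx_onto W w : w \in W -> exists t : 'rV[R]_(\dim W), w = t *m basis_mx W.
Proof.
move=> wW; exists (\row_j coord (vbasis W) j w);
  rewrite {1}(coord_vbasis wW) mulmx_sum_row.
by apply: eq_bigr => j _; rewrite mxE rowK.
Qed.

Lemma basis_mx_inj W (t : 'rV[R]_(\dim W)) : t *m basis_mx W = 0 -> t = 0.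
Proof.
move=> t0; apply/rowP => j; rewrite mxE.
have /freeP := basis_free (vbasisP W); apply.
rewrite -[RHS]t0 mulmx_sum_row; apply: eq_bigr => i _; by rewrite rowK.
Qed.

Lemma form_ofE Q v w : form_of Q v w = (v *m (Q *m w^T)) 0 0.
Proof. by rewrite /form_of mulmxA. Qed.

Lemma form_ofDl Q v1 v2 w : form_of Q (v1 + v2) w = form_of Q v1 w + form_of Q v2 w.
Proof. by rewrite !form_ofE mulmxDl mxE. Qed.

Lemma form_ofNl Q v w : form_of Q (- v) w = - form_of Q v w.
Proof. by rewrite !form_ofE mulNmx mxE. Qed.

(** The normal equations are solved with the Gram matrix [G], which is invertible by positivity on
    [W]. Projections enter the hypotheses as a pointwise relation; the matrix makes them linear, so
    that smoothness of [mu] is inherited. *)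
Lemma orth_proj_mx Q W : (forall w, w \in W -> w != 0 -> 0 < form_of Q w w) ->
  exists P : 'M[R]_n, forall x y, is_orth_proj Q W x y -> y = x *m P.
Proof.
move=> Qpos; pose b := basis_mx W; pose G := b *m Q *m b^T.
have uG : G \in unitmx.
  rewrite -row_free_unit -kermx_eq0; apply/eqP/row_matrixP => i; rewrite row0.
  set v := row i _; apply: basis_mx_inj; apply/eqP/negPn/negP => v0.
  have := Qpos _ (mem_basis_mx v) v0.
  have vG : v *m G = 0 by rewrite -row_mul mulmx_ker row0.
  have -> : form_of Q (v *m basis_mx W) (v *m basis_mx W) = (v *m G *m v^T) 0 0.
    by rewrite /form_of trmx_mul /G !mulmxA.
  by rewrite vG mul0mx mxE ltxx.
exists (Q *m b^T *m invmx G *m b) => x y [yW yo].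
have [t ty] := basis_mx_onto yW; rewrite ty.
have e : (x - y) *m Q *m b^T = 0.
  apply/rowP => j; rewrite [RHS]mxE.
  have rW : row j b \in W by rewrite rowE; exact: mem_basis_mx.
  rewrite -[RHS](yo _ rW) /form_of [LHS]mxE [RHS]mxE.
  by apply: eq_bigr => i _; congr (_ * _); rewrite !mxE.
move: e; rewrite ty !mulmxBl => /eqP; rewrite subr_eq0 => /eqP e.
have eG : t *m basis_mx W *m Q *m b^T = t *m G by rewrite /G !mulmxA.
by rewrite !mulmxA e eG mulmxK.
Qed.

End OrthProj.

(** * Orbits of the action and pushforward measures *)

Section Action.
Context {R : realType} {n m : nat} (UC : complex_lie_group R n)
  (Z : complex_manifold R m).
Local Notation L := 'rV[R]_(n + n).
Local Notation W := 'rV[R]_(m + m).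
Variables (expo : L -> UC) (act : UC -> Z -> Z).
Hypothesis hexp : is_exponential expo.
Hypothesis hact : is_holomorphic_action act.

Lemma act_one z : act lone z = z. Proof. by case: hact. Qed.
Lemma act_mul g h z : act (lmul g h) z = act g (act h z). Proof. by case: hact. Qed.

Lemma actK g z : act (linv g) (act g z) = z.
Proof. by rewrite -act_mul lmulV act_one. Qed.

Lemma msmooth_act (E : normedModType R) P (f : E -> UC) (g : E -> Z) y :
  msmooth P f y -> msmooth P g y -> msmooth P (fun x => act (f x) (g x)) y.
Proof. by apply: msmooth_map2; case: hact. Qed.

Lemma act_continuous g : continuous (act g).
Proof.
move=> z; have [c ac cz] := atlas_cover z.
have s : msmooth set0 (fun y : W => act g (cinv c y)) (c z).
  apply: msmooth_act; first exact: msmooth_cst.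
  by apply: msmooth_weaken; apply: msmooth_cinv => //; exact: chart_img.
exact: (continuous_through_chart cz s.1).
Qed.

Lemma msmooth_orbit (X : L) z (t : R) :
  msmooth set0 (fun t : R => act (expo (t *: X)) z) t.
Proof. by apply: msmooth_act; [exact: msmooth_expo_line|exact: msmooth_cst]. Qed.

(* The flow maps are differentiable, so a zero of the fundamental vector field
   has null velocity all along its orbit. *)
Lemma fixed_of_null_field (X : L) (w : Z) (c : chart Z W) : atlas c -> cdom c w ->
  fundamental_field expo act c X w = 0 -> forall t : R, act (expo (t *: X)) w = w.
Proof.
move=> ac cw; rewrite /fundamental_field derive1E => f0 t.
pose f (t : R) := act (expo (t *: X)) w.
have fz : f 0 = w by rewrite /f scale0r (expo0 hexp) act_one.
have sf s : msmooth set0 f s by exact: msmooth_orbit.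
rewrite -/(f t) -[RHS]fz; apply: constant_of_null_velocity => // s.
have [d ad ds] := atlas_cover (f s); exists d; split=> //.
have := (derive_translate (d \o f) s 0 (1 : R)).1; rewrite addr0 => <-.
pose phi x := d (act (expo (s *: X)) x).
have -> : (fun h : R => (d \o f) (s + h)) = phi \o f.
  by apply/funext => h; rewrite /phi /= /f -act_mul -(expo_add hexp).
have cf : cdom c (f 0) by rewrite fz.
rewrite (derive_through_chart _ (sf 0).1 cf); first last.
- have sg : msmooth set0 (fun y : W => act (expo (s *: X)) (cinv c y)) (c (f 0)).
    apply: msmooth_act; first exact: msmooth_cst.
    by apply: msmooth_weaken; apply: msmooth_cinv => //; exact: chart_img.
  have ds' : cdom d (act (expo (s *: X)) (cinv c (c (f 0)))) by rewrite cfunK// fz.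
  exact: smooth_at_differentiable (msmooth_chart sg ad ds').
- exact: smooth_at_differentiable (msmooth_chart (sf 0) ac cf).
by rewrite f0 derive0.
Qed.

Lemma smooth_at_mulmx_coord (E : normedModType R) a b (f : E -> 'rV[R]_a)
  (D : 'M[R]_(a, b)) j y :
  smooth_at set0 setT f y -> smooth_at set0 setT (fun x => (f x *m D) 0 j) y.
Proof.
move=> [ O [oO Oy Cf _]]; exists O; split=> // k.
exact: ((Ck_on_rowP k (fun x => f x *m D) oO).1 (Ck_on_mulmx D oO (Cf k))).
Qed.

Lemma jsmooth_act N (O : set 'rV[R]_N) (p : 'rV[R]_N -> UC) q (mu : Z -> 'rV[R]_q) b
    (D : 'M[R]_(q, b)) j :
  smooth_map (@atlas R m Z) (flat_atlas 'rV[R]_q) setT mu ->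
  (forall y, O y -> msmooth set0 p y) ->
  jsmooth O (fun y (z : Z) => (mu (act (p y) z) *m D) 0 j).
Proof.
move=> smu sp y z Oy; have [c ac cz] := atlas_cover z; exists c; split=> //.
have s1 : msmooth set0 (fun r : 'rV[R]_N * W => p r.1) (y, c z).
  apply: (msmooth_comp (Q := set0) (f := fun r : 'rV[R]_N * W => r.1));
    last exact: sp.
  by apply: smooth_at_weaken; apply: smooth_at_linear => r; exact: is_diff_fst.
have s2 : msmooth set0 (fun r : 'rV[R]_N * W => cinv c r.2) (y, c z).
  apply: (msmooth_comp (Q := set0) (f := fun r : 'rV[R]_N * W => r.2)).
    by apply: smooth_at_weaken; apply: smooth_at_linear => r; exact: is_diff_snd.
  by apply: msmooth_weaken; apply: msmooth_cinv => //; exact: chart_img.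
exact: smooth_at_mulmx_coord (smooth_at_map_flat smu (msmooth_act s1 s2)).
Qed.

Lemma msmooth_smooth_map k (T : set 'rV[R]_k) (f : 'rV[R]_k -> UC) :
  (forall y, T y -> msmooth set0 f y) ->
  smooth_map (flat_atlas 'rV[R]_k) (@atlas R n UC) T f.
Proof.
move=> sf y Ty; have [cf [d [ad dy [ O [oO Oy Cd _]]]]] := sf y Ty.
have [ O1 [oO1 O1y HO1]] := near_open (chart_dom_near cf dy).
exists (id_chart _), d, (O `&` O1), (d \o f); split=> //; first by split=> //;
  exact: openI.
  by move=> k'; apply: Ck_on_sub (Cd k') => x [].
by move=> x Tx _ [_ /HO1].
Qed.

Lemma msmooth_expo_mulmx k (b : 'M[R]_(k, n + n)) y :
  msmooth set0 (fun t : 'rV[R]_k => expo (t *m b)) y.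
Proof.
apply: (msmooth_comp (Q := set0) (f := fun t : 'rV[R]_k => t *m b)).
  exists setT; split=> //; first exact: openT.
  by move=> k'; apply: Ck_on_mulmx; [exact: openT|exact: Ck_on_id].
by case: hexp => sexp _ _; exact: (msmooth_flat _ sexp).
Qed.

Variable nu : probability (borel Z) R.
Variable M : set Z.
Hypothesis cM : compact M.
Hypothesis cZ : compact [set: Z].

Lemma Rintegral_push g (psi : Z -> R) : continuous psi -> act g @^-1` M = M ->
  fine (integral (push (act g) nu) M (fun z => (psi z)%:E)) = \int[nu]_(z in M) psi
    (act g z).
Proof.
move=> cpsi gM; have mg := continuous_borel (@act_continuous g).
have mM := borelM cM.
have /measurable_EFinP mpsi := continuous_borel_real cpsi.
have cpg : continuous (psi \o act g).
  by move=> z; apply: continuous_comp; [exact: act_continuous|exact: cpsi].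
have intf := integrableM nu cM cZ cpg.
rewrite /Rintegral; congr fine.
have := @integral_pushforward _ _ (borel Z) (borel Z) R (act g) mg nu M _ mpsi.
by rewrite gM => /(_ intf mM).
Qed.

(** A Borel set and its preimage differ only inside the null set [N] off which [g] fixes every
    point. *)
Lemma push_eq_of_ae g : measurable_fun setT (act g : borel Z -> borel Z) ->
  {ae nu, forall z, act g z = z} ->
  forall E : set (borel Z), measurable E -> push (act g) nu E = nu E.
Proof.
move=> mg [N [mN N0 HN]] E mE.
have mgE : measurable ((act g : borel Z -> borel Z) @^-1` E).
  by rewrite -[X in measurable X]setTI; exact: mg.
have out z : ~ N z -> act g z = z by move=> Nz; apply: contrapT => /HN.
have le (A B : set (borel Z)) : measurable A -> measurable B -> A `<=` B `|` N ->
  (nu A <= nu B)%E.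
  move=> mA mB AB; apply: (@le_trans _ _ (nu (B `|` N))).
    by apply: le_measure => //; rewrite inE //; exact: measurableU.
  rewrite (le_trans (measureU2 _ mB mN))//.
  by rewrite [X in (_ + X <= _)%E](N0 : nu N = 0) adde0.
apply/eqP; rewrite eq_le /push /pushforward; apply/andP; split; apply: le => //.
  by move=> z Ez; have [Nz|/out gz] := pselect (N z); [right|left; rewrite -gz].
by move=> z Ez; have [Nz|/out gz] := pselect (N z); [right|left; rewrite /= gz].
Qed.

End Action.

(** * Monotonicity of the gradient map along a flow *)

Section Gradient.
Context {R : realType} {n m : nat}.
Context (UC : complex_lie_group R n) (Z : complex_manifold R m).
Local Notation L := 'rV[R]_(n + n).
Local Notation W := 'rV[R]_(m + m).
Variables (expo : L -> UC) (u : {vspace L}) (act : UC -> Z -> Z).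
Hypothesis hexp : is_exponential expo.
Hypothesis hact : is_holomorphic_action act.
Variables (Q B : 'M[R]_(n + n)) (p a : {vspace L}) (omega : chart_form Z)
  (mu mup mua : Z -> L).
Hypothesis hmu : smooth_map (@atlas R m Z) (flat_atlas L) setT mu.
Hypothesis homega : is_kahler omega.
Hypothesis Qpos : forall X, X \in u -> X != 0 -> 0 < form_of Q X X.
Hypothesis Bpos : forall X, X \in ivs u -> X != 0 -> 0 < form_of B X X.
Hypothesis pu : (p <= ivs u)%VS.
Hypothesis hap : (a <= p)%VS.
Hypothesis hmup : is_gradient_map Q p mu mup.
Hypothesis hnorm : gradient_normalized expo act B p omega mup.
Hypothesis hmua : forall z, is_orth_proj B a (mup z) (mua z).

Lemma gradient_map_mx : exists C : 'M[R]_(n + n), forall z, mup z = mu z *m C.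
Proof.
(* As [p] lies in [i u] and [i^2 = -1], the subspace [i p] lies in [u], where [Q] is positive
   definite. *)
have ivs2 X : X \in ivs p -> X \in u.
  move=> /mem_ivs[Y /(subvP pu)/mem_ivs[Y' uY ->] ->].
  by rewrite muliK rpredN.
have [P HP] := @orth_proj_mx _ _ Q (ivs p) (fun X pX => Qpos (ivs2 X pX)).
exists (- (P *m imx R n)) => z; have [y /HP -> ->] := hmup z.
by rewrite /muli mulmxN mulmxA.
Qed.

Lemma abelian_map_mx : exists C : 'M[R]_(n + n), forall z, mua z = mu z *m C.
Proof.
have [C HC] := gradient_map_mx.
have au X : X \in a -> X \in ivs u by move=> /(subvP hap)/(subvP pu).
have [P HP] := @orth_proj_mx _ _ B a (fun X aX => Bpos (au X aX)).
by exists (C *m P) => z; rewrite (HP _ _ (hmua z)) HC mulmxA.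
Qed.

Lemma derive_along_flow (X : L) w : X \in a ->
  let D := 'D_1 (fun s : R => form_of B (mua (act (expo (s *: X)) w)) X) 0 in
  0 <= D /\ (D = 0 -> forall s : R, act (expo (s *: X)) w = w).
Proof.
move=> aX D; have pX := subvP hap _ aX.
have [C HC] := gradient_map_mx.
pose phi z := form_of B (mup z) X.
have phiE : phi = fun z => (mu z *m (C *m (B *m X^T))) 0 0.
  by apply/funext => z; rewrite /phi form_ofE HC !mulmxA.
pose f (s : R) := act (expo (s *: X)) w.
have fw : f 0 = w by rewrite /f scale0r (expo0 hexp) (act_one hact).
(* The difference of [mup] and [mua] is orthogonal to [a], so both have the same pairing with [X];
   the gradient property is available for [mup]. *)
have DE : D = 'D_1 (phi \o f) 0.
  have -> // : phi \o f = (fun s : R => form_of B (mua (f s)) X).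
  apply/funext => s; rewrite /phi /=.
  have [_ /(_ X aX)] := hmua (f s); rewrite form_ofDl form_ofNl => /eqP.
  by rewrite subr_eq0 => /eqP ->.
have sf : msmooth set0 f 0 := msmooth_orbit hexp hact X w 0.
have [c ac cw] := atlas_cover w; have cf : cdom c (f 0) by rewrite fw.
have sc : msmooth set0 (cinv c) (c (f 0)).
  by apply: msmooth_weaken; apply: msmooth_cinv => //; exact: chart_img.
have dphi : differentiable (phi \o cinv c) (c (f 0)).
  rewrite phiE;
    exact:
      smooth_at_differentiable
        (smooth_at_mulmx_coord _ _ (smooth_at_map_flat hmu sc)).
have :=
  derive_through_chart (1 : R) sf.1 cf
    (smooth_at_differentiable (msmooth_chart sf ac cf)) dphi.
rewrite -DE fw.
have -> : 'D_1 (c \o f) 0 = fundamental_field expo act c X w.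
  by rewrite /fundamental_field derive1E.
set xi := fundamental_field expo act c X w => De.
have Dm : D = metric omega c (c w) xi xi by rewrite De; exact: hnorm.
have [_ /(_ c ac) [_ _ _ mpos _]] := homega.
have cw' : (c @` cdom c) (c w) by exists w.
have [xi0|xi0] := eqVneq xi 0.
  split; last by move=> _; exact: (fixed_of_null_field hexp hact ac cw xi0).
  by rewrite Dm xi0 /metric /form_of !mul0mx mxE.
have := mpos _ _ cw' xi0; rewrite -Dm => D0.
by split; [exact: ltW|move=> D0'; move: D0; rewrite D0' ltxx].
Qed.

End Gradient.

(** * The orbit of the measure *)

Section Orbit.
Context {R : realType} {n m : nat}.
Context (UC : complex_lie_group R n) (Z : complex_manifold R m).
Local Notation L := 'rV[R]_(n + n).
Local Notation W := 'rV[R]_(m + m).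
Variables (expo : L -> UC) (act : UC -> Z -> Z).
Hypothesis hexp : is_exponential expo.
Hypothesis hact : is_holomorphic_action act.
Variables (B : 'M[R]_(n + n)) (a : {vspace L}) (mu mua : Z -> L) (C : 'M[R]_(n + n)).
Hypothesis hmu : smooth_map (@atlas R m Z) (flat_atlas L) setT mu.
Hypothesis muaE : forall z, mua z = mu z *m C.
Hypothesis mua_in : forall z, mua z \in a.
Hypothesis Bpos : forall X, X \in a -> X != 0 -> 0 < form_of B X X.
Hypothesis expoD : forall X Y, X \in a -> Y \in a ->
  expo (X + Y) = lmul (expo X) (expo Y).
Hypothesis flow : forall X w, X \in a ->
  let D := 'D_1 (fun s : R => form_of B (mua (act (expo (s *: X)) w)) X) 0 in
  0 <= D /\ (D = 0 -> forall s : R, act (expo (s *: X)) w = w).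
Variables (M : set Z) (nu : probability (borel Z) R).
Hypothesis cM : compact M.
Hypothesis cZ : compact [set: Z].
Hypothesis nuM : nu M = 1%E.
Hypothesis Mstable : forall X z, X \in a -> M z -> M (act (expo X) z).
Let A := expo @` [set` a].
Hypothesis hnu : lie_of expo (measure_isotropy act A nu) = [set 0].

Let k := \dim a.
Let V := 'rV[R]_k.
Let b : 'M[R]_(k, n + n) := basis_mx a.
Let pt (t : V) : UC := expo (t *m b).

Let b_in (t : V) : t *m b \in a. Proof. exact: mem_basis_mx. Qed.

Let pt_smooth (t : V) : msmooth set0 pt t.
Proof. exact: (msmooth_expo_mulmx hexp). Qed.

Lemma preimage_stable X : X \in a -> act (expo X) @^-1` M = M.
Proof.
move=> aX; apply/seteqP; split=> z /= Mz; last exact: Mstable.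
have := @Mstable (- X) _; rewrite rpredN => /(_ _ aX Mz).
by rewrite -(expoN hexp) (actK hact).
Qed.

Let comp_fun (D : 'M[R]_(n + n, 1)) (t : V) (z : Z) : R :=
  (mua (act (pt t) z) *m D) 0 0.

Let comp_smooth D : jsmooth setT (comp_fun D).
Proof.
have -> : comp_fun D = fun t (z : Z) => (mu (act (pt t) z) *m (C *m D)) 0 0.
  by apply/funext => t; apply/funext => z; rewrite /comp_fun muaE mulmxA.
exact: (jsmooth_act hact (C *m D) 0 hmu (fun t _ => pt_smooth t)).
Qed.

Let g (v t : V) (z : Z) := comp_fun (B *m (v *m b)^T) t z.

Lemma flow_derive v t z : let D := 'D_v (g v ^~ z) t in
  0 <= D /\ (D = 0 -> forall s : R, act (expo (s *: (v *m b))) z = z).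
Proof.
set D := 'D_v _ _; pose X := v *m b; pose w := act (pt t) z.
have comm X' Y' : X' \in a -> Y' \in a -> lmul (expo X') (expo Y') = lmul (expo Y')
  (expo X').
  by move=> aX aY; rewrite -!expoD// addrC.
have aX (s : R) : s *: X \in a by apply: rpredZ; exact: b_in.
have DE : D = 'D_1 (fun s : R => form_of B (mua (act (expo (s *: X)) w)) X) 0.
  have -> : (fun s : R => form_of B (mua (act (expo (s *: X)) w)) X) =
            (fun s : R => g v (s *: v + t) z).
    apply/funext => s; rewrite /g /comp_fun form_ofE -/X /w -(act_mul hact) /pt.
    by rewrite mulmxDl -scalemxAl expoD// ?aX// b_in.
  have dg : derivable (g v ^~ z) ((0 : R) *: v + t) v.
    exact/diff_derivable/(jsmooth_differentiable z (@comp_smooth _) I).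
  by have [_ ->] := is_derive_line dg; rewrite scale0r add0r.
have [D0 Dfix] := flow w (b_in v); rewrite -/X -DE in D0 Dfix.
split=> // /Dfix fixw s.
(* The flow of [X] fixes [w = act (pt t) z]. It commutes with [pt t], which can then be cancelled to
   reach [z] itself. *)
have e : act (pt t) (act (expo (s *: X)) z) = act (pt t) z.
  by rewrite -(act_mul hact) (comm _ _ (b_in t) (aX s)) (act_mul hact); exact: fixw.
by rewrite -(actK hact (pt t) (act _ z)) e (actK hact).
Qed.

(** The entries are pairings of the averaged [mua] with the basis vectors of [a]. Hence
    [dot (f t) v] is the pairing with [v *m b], whether or not the basis is orthonormal. *)
Let f (t : V) : V := \row_j pint nu M (g 'e_j) t.

Lemma orbit_map_smooth : smooth_on setT f.
Proof.
move=> i; apply/Ck_on_rowP => [|j]; first exact: openT.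
have := pint_Ck nu cM cZ openT i (comp_smooth (B *m ('e_j *m b)^T)).
by apply: Ck_on_ext => [|t _]; [exact: openT|rewrite mxE].
Qed.

Let gsum v t z : 'D_v (g v ^~ z) t = \sum_j v 0 j * 'D_v (g 'e_j ^~ z) t.
Proof.
have dj j : is_derive t v (v 0 j *: (g 'e_j ^~ z)) (v 0 j *: 'D_v (g 'e_j ^~ z) t).
  apply: is_deriveZ; apply: derivableP; apply: diff_derivable.
  exact: (jsmooth_differentiable z (@comp_smooth _) I).
have e : \sum_j (v 0 j *: (g 'e_j ^~ z)) = g v ^~ z.
  apply/funext => s; rewrite fct_sumE /g /comp_fun [in RHS](row_sum_delta v).
  rewrite mulmx_suml linear_sum /= !mulmx_sumr summxE; apply: eq_bigr => j _.
  by rewrite -scalemxAl linearZ /= -!scalemxAr mxE.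
by have [_] := is_derive_sum dj; rewrite e.
Qed.

Lemma orbit_map_dot v t :
  dot ('D_v f t) v = pint nu M (fun t z => 'D_v (g v ^~ z) t) t.
Proof.
have df : differentiable f t := (orbit_map_smooth 1).1 t I.
pose G j z := 'D_v (g 'e_j ^~ z) t.
have cG j : continuous (G j).
  exact:
    (jsmooth_continuous2 (jsmooth_derive v (comp_smooth (B *m ('e_j *m b)^T))) I).
rewrite /pint; under eq_Rintegral do rewrite gsum.
rewrite (Rintegral_lincomb nu cM cZ (fun j => v 0 j) cG).2.
apply: eq_bigr => j _; rewrite mulrC; congr (_ * _).
rewrite (derive_row j (diff_derivable df)).
have -> : (fun t => f t 0 j) = pint nu M (g 'e_j) by apply/funext => s; rewrite mxE.
by rewrite (pint_derivable nu cM cZ openT (comp_smooth (B *m ('e_j *m b)^T)) I).2.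
Qed.

Lemma orbit_map_pos (t v : V) : v != 0 -> 0 < dot ('D_v f t) v.
Proof.
move=> v0; rewrite orbit_map_dot /pint.
pose q (z : Z) : R := 'D_v (g v ^~ z) t.
have cq : continuous q :=
  jsmooth_continuous2 (jsmooth_derive v (comp_smooth (B *m (v *m b)^T))) I.
have q0 z : 0 <= q z := (flow_derive v t z).1.
have Ige0 : 0 <= \int[nu]_(z in M) q z by apply: Rintegral_ge0 => z _; exact: q0.
rewrite lt_neqAle Ige0 andbT eq_sym; apply/eqP => I0.
have mM := borelM cM.
have iq := integrableM nu cM cZ cq.
have Iq0 : (\int[nu]_(z in M) `|(q z)%:E| = 0)%E.
  under eq_integral do rewrite gee0_abs ?lee_fin ?q0//.
  by rewrite -(fineK (integrable_fin_num mM iq)) [fine _]I0.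
have /integrableP[mq _] := iq.
have ae0 := (ae_eq_integral_abs nu mM mq).1 Iq0.
(* The integral sees only [M], while the isotropy group is tested on all Borel sets of [Z];
   [nu M = 1] bridges the two. *)
have aeM : {ae nu, forall z : borel Z, M z}.
  exists (~` M); split; [exact: measurableC| |by []].
  by rewrite probability_setC// nuM subee.
have aefix (s : R) : {ae nu, forall z : borel Z, act (expo (s *: (v *m b))) z = z}.
  apply: filterS2 ae0 aeM => z qz Mz.
  apply: (flow_derive v t z).2; have := qz Mz; by move=> [].
have : lie_of expo (measure_isotropy act A nu) (v *m b).
  move=> s; split; first by exists (s *: (v *m b)) => //=; apply: rpredZ;
    exact: b_in.
  have ca : continuous (act (expo (s *: (v *m b)))) by exact: act_continuous.
  exact: push_eq_of_ae (continuous_borel ca) (aefix s).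
rewrite hnu /= => vb0; move: v0; by rewrite (basis_mx_inj vb0) eqxx.
Qed.

Let F (x : UC) : L := vintegral M mua (push (act x) nu).

Let mua_continuous q (D : 'M[R]_(n + n, q)) j :
  continuous (fun z => (mua z *m D) 0 j : R).
Proof.
have -> : (fun z => (mua z *m D) 0 j) = (fun z => (mu z *m (C *m D)) 0 j).
  by apply/funext => z; rewrite muaE mulmxA.
have cmu : continuous mu := smooth_map_continuous hmu.
move=> z;
  have c1 := continuous_comp (cmu z) (@continuous_mulmxr _ _ _ (C *m D) (mu z)).
exact: (continuous_comp c1 (@coord_continuous _ _ _ 0 j _)).
Qed.

(** The integral is defined entry by entry; this lets any matrix pass through it. It is used with
    the identity, with a projection onto [a], and with the pairing matrix [D0]. *)
Lemma orbit_integral q (D : 'M[R]_(n + n, q)) t j :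
  (F (pt t) *m D) 0 j = \int[nu]_(z in M) (mua (act (pt t) z) *m D) 0 j.
Proof.
pose G i z := mua (act (pt t) z) 0 i.
have cm i : continuous (fun z => mua z 0 i).
  have -> : (fun z => mua z 0 i) = (fun z => (mua z *m 1%:M) 0 i).
    by apply/funext => z; rewrite mulmx1.
  exact: mua_continuous.
have ca : continuous (act (pt t)) by exact: act_continuous.
have cG i : continuous (G i).
  by move=> z; exact: (continuous_comp (ca z) (cm i _)).
transitivity (\sum_i D i j * \int[nu]_(z in M) G i z).
  rewrite mxE; apply: eq_bigr => i _; rewrite mulrC mxE; congr (_ * _).
  exact: (Rintegral_push hact nu cM cZ (cm i) (preimage_stable (b_in t))).
rewrite -(Rintegral_lincomb nu cM cZ (fun i => D i j) cG).2.
by apply: eq_Rintegral => z _; rewrite mxE; apply: eq_bigr => i _; exact: mulrC.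
Qed.

(** The subspace [a] is the fixed space of a matrix, which commutes with the integral. *)
Lemma orbit_map_in t : F (pt t) \in a.
Proof.
have [P PA] := vspace_mx a; rewrite PA; apply/eqP/rowP => j.
rewrite orbit_integral -[in RHS](mulmx1 (F (pt t))) orbit_integral.
by apply: eq_Rintegral => z _; rewrite mulmx1; have := mua_in (act (pt t) z);
  rewrite PA => /eqP ->.
Qed.

Let D0 : 'M[R]_(n + n, k) := B *m b^T.

Lemma orbit_map_coord t : f t = F (pt t) *m D0.
Proof.
apply/rowP => j; rewrite mxE orbit_integral; apply: eq_Rintegral => z _.
rewrite /g /comp_fun /D0 !mulmxA [LHS]mxE [RHS]mxE.
by apply: eq_bigr => i _; congr (_ * _); rewrite -rowE !mxE.
Qed.

(** A vector of [a] orthogonal to a basis of [a] is orthogonal to itself. Through this, statements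
    about [f] return to [F]. *)
Lemma coord_inj y : y \in a -> y *m D0 = 0 -> y = 0.
Proof.
move=> ya y0; apply/eqP/negPn/negP => yN0; have := Bpos ya yN0.
have [t yt] := basis_mx_onto ya.
have -> : form_of B y y = (y *m D0 *m t^T) 0 0.
  by rewrite {2}yt /form_of trmx_mul /D0 !mulmxA.
by rewrite y0 mul0mx mxE ltxx.
Qed.

Lemma orbitP x : A x -> exists t, x = pt t.
Proof. by move=> [X /basis_mx_onto[t ->] <-]; exists t. Qed.

Lemma orbit_pt t : A (pt t). Proof. by exists (t *m b) => //=; exact: b_in. Qed.

Lemma orbit_image_convex : convex_set (F @` A).
Proof.
move=> y0 y1 l; rewrite !inE => -[x0 /orbitP[t0 ->] <-] [x1 /orbitP[t1 ->] <-].
(* In [convex_set] the weight [l] sits on the first point, whereas the segment of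
   [monotone_range_convex] starts there; hence the parameter [1 - l]. *)
have l01 : 0 <= 1 - l%:num <= 1.
  by rewrite subr_ge0 lerBlDr lerDl; apply/andP.
have [t ft] := monotone_range_convex orbit_map_smooth orbit_map_pos t0 t1 l01.
exists (pt t); first exact: orbit_pt.
change (F (pt t) = l%:num *: F (pt t0) + (1 - l%:num) *: F (pt t1)).
apply/eqP; rewrite -subr_eq0; apply/eqP/coord_inj.
  by rewrite rpredB ?rpredD ?rpredZ ?orbit_map_in.
rewrite mulmxBl mulmxDl -!scalemxAl -!orbit_map_coord ft.
move: (f t0) (f t1) (l%:num) => u0 u1 r; apply/rowP => j; rewrite !mxE; ring.
Qed.

(** A local representative needs an open subset of the group, whose elements outside [A] may fail to
    preserve [M]. So [h] integrates [mua (act y z)] over [M] instead of using the pushforward; both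
    agree on [A] by [orbit_integral]. *)
Let smooth_F : smooth_map (@atlas R n UC) (flat_atlas L) A F.
Proof.
move=> x Ax; have [c ac cx] := atlas_cover x.
pose h (y : L) : L :=
  \row_j pint nu M (fun y z => (mu (act (cinv c y) z) *m C) 0 j) y.
exists c, (id_chart L), (c @` cdom c), h; split.
- by split.
- by split; [exact: cimg_open|exact: chart_img].
- move=> i; apply/Ck_on_rowP => [|j]; first exact: cimg_open.
  have sc (y : L) : (c @` cdom c) y -> msmooth set0 (cinv c) y.
    by move=> cy; apply: msmooth_weaken; exact: msmooth_cinv.
  have := pint_Ck nu cM cZ (cimg_open c) i (jsmooth_act hact C j hmu sc).
  by apply: Ck_on_ext => [|y _]; [exact: cimg_open|rewrite mxE].
- move=> y /orbitP[t ->] cy _; split=> //; apply/rowP => j.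
  rewrite /= -[LHS]/(F (pt t) 0 j) -(mulmx1 (F (pt t))) orbit_integral mxE /pint
    cfunK//.
  by apply: eq_Rintegral => z _; rewrite mulmx1 muaE.
Qed.

(** The inverse is [y |-> pt (inverse_fun f (y *m D0))]. It is smooth on the set of all [y] with
    [y *m D0] in the range of [f], an open set of the Lie algebra that contains the image. *)
Lemma orbit_diffeo : diffeo_onto (@atlas R n UC) (flat_atlas L) A (F @` A) F.
Proof.
split=> //.
pose G (y : L) : UC := pt (inverse_fun f (y *m D0)).
exists G; split; last first.
  move=> _ /orbitP[t ->]; rewrite /G -orbit_map_coord.
  by rewrite (inverse_funK orbit_map_smooth orbit_map_pos).
apply: msmooth_smooth_map => _ [_ /orbitP[t ->] <-].
apply: (msmooth_comp (Q := set0) (f := fun y => inverse_fun f (y *m D0)));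
  last exact: pt_smooth.
apply: (smooth_at_comp (Q := set0) (f := fun y : L => y *m D0)).
  exists setT; split=> //; first exact: openT.
  by move=> i; apply: Ck_on_mulmx; [exact: openT|exact: Ck_on_id].
rewrite -orbit_map_coord; exists (range f); split=> //.
- exact: range_monotone_open orbit_map_smooth orbit_map_pos.
- exact: smooth_inverse_fun orbit_map_smooth orbit_map_pos.
Qed.

End Orbit.

Theorem corollary4p4 (R : realType) (n m : nat)
  (UC : complex_lie_group R n) (expo : 'rV[R]_(n + n) -> UC)
  (U : set UC) (u : {vspace 'rV[R]_(n + n)})
  (hexp : is_exponential expo)
  (hU : is_complexification expo U u)
  (Z : complex_manifold R m) (omega : chart_form Z)
  (hZcompact : compact [set: Z]) (hZconnected : connected [set: Z])
  (homega : is_kahler omega)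
  (act : UC -> Z -> Z)
  (hact : is_holomorphic_action act)
  (hUomega : forall k, U k -> preserves_form omega (act k))
  (Q : 'M[R]_(n + n)) (hQ : is_invariant_scalar_product expo U u Q)
  (mu : Z -> 'rV[R]_(n + n))
  (hmu : is_momentum_map expo act U u Q omega mu)
  (B : 'M[R]_(n + n)) (hB : is_admissible_form expo u B)
  (G : set UC) (g : {vspace 'rV[R]_(n + n)})
  (hG : is_compatible expo U u G g)
  (p := (g :&: ivs u)%VS)
  (mup : Z -> 'rV[R]_(n + n))
  (hmup : is_gradient_map Q p mu mup)
  (hnorm : gradient_normalized expo act B p omega mup)
  (M : set Z) (hMcompact : compact M) (hMsub : real_submanifold M)
  (hMstable : forall x z, G x -> M z -> M (act x z))
  (a : {vspace 'rV[R]_(n + n)}) (hap : (a <= p)%VS)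
  (ha : forall X Y, X \in a -> Y \in a -> bracket expo X Y \in a)
  (A := expo @` [set` a])
  (mua : Z -> 'rV[R]_(n + n))
  (hmua : forall z, is_orth_proj B a (mup z) (mua z))
  (* P(M) is the set of Borel probability measures on Z carried by M *)
  (nu : probability (borel Z) R) (hnuM : nu M = 1%E)
  (hnu : lie_of expo (measure_isotropy act A nu) = [set 0])
  (F := fun x : UC => vintegral M mua (push (act x) nu)) :
  [/\ F @` A `<=` [set` a],
      convex_set (F @` A) &
      diffeo_onto (@atlas R n UC) (flat_atlas 'rV[R]_(n + n)) A (F @` A) F].
Proof.
have [[gU _ _ hUu] [_ uiu0] _ _] := hU.
have [smu _ _ _] := hmu.
have pu : (p <= ivs u)%VS := capvSr _ _.
have [gG _ gg _ _] := hG.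
have [_ Qpos _] := hQ; have [_ _ Bpos _ _] := hB.
have [C HC] := abelian_map_mx Qpos Bpos pu hap hmup hmua.
have au : (a <= ivs u)%VS := subv_trans hap pu.
have Bpos' X : X \in a -> X != 0 -> 0 < form_of B X X by move=> /(subvP au);
  exact: Bpos.
have expoD X Y : X \in a -> Y \in a -> expo (X + Y) = lmul (expo X) (expo Y).
  move=> aX aY; apply: (commute_of_bracket hexp).
  exact: (bracket_ivs_eq0 hexp gU hUu uiu0 au ha aX aY).
have mua_in z : mua z \in a by have [] := hmua z.
have flow X w (aX : X \in a) :=
  derive_along_flow hexp hact smu homega Qpos pu hap hmup hnorm hmua w aX.
have Mst X z : X \in a -> M z -> M (act (expo X) z).
  move=> /(subvP hap) /(subvP (capvSl _ _)) gX; apply: hMstable.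
  have : lie_of expo G X by rewrite -gg.
  by move=> /(_ 1); rewrite scale1r.
split.
- move=> _ [x /orbitP[t ->] <-].
  exact: (orbit_map_in hexp hact smu HC mua_in nu hMcompact hZcompact Mst).
- exact:
  (orbit_image_convex hexp hact smu HC mua_in Bpos' expoD flow hMcompact hZcompact
    hnuM Mst hnu).
- exact: (orbit_diffeo hexp hact smu HC expoD flow hMcompact hZcompact hnuM Mst hnu).
Qed.
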